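(* Let $(M,g)$ be a connected geodesically complete Riemannian manifold, let $X$ be a smooth vector field on $M$, let $p_0,q_0\in M$, and let $p(t)=\mathrm{Fl}^X_t(p_0)$ and $q(t)=\mathrm{Fl}^X_t(q_0)$. Let $S$ be a minimizing geodesic segment connecting $p_0$ and $q_0$, and choose some $T>0$ such that $\mathrm{Fl}^X$ is defined on $[0,T]\times S$. Then $$d(p(t),q(t))\le d(p_0,q_0)\,e^{C_T t}\qquad (t\in[0,T])$$ holds with $C_T=\sup\{\|\nabla X(p)\|_g : p\in\mathrm{Fl}^X([0,T]\times S)\}$. In particular, if $X$ is complete, then for any $T>0$ we have, with $C_T$ given by the same formula, $$d(p(t),q(t))\le d(p_0,q_0)\,e^{C_T t}\qquad (t\in[0,T]).$$
   Context: $d$ denotes the Riemannian distance on $(M,g)$. A minimizing geodesic segment connecting $p_0$ and $q_0$ is (the image of) a geodesic from $p_0$ to $q_0$ whose length equals $d(p_0,q_0)$. $\nabla$ denotes the Levi-Civita connection of $(M,g)$, and $\nabla X$ is the covariant differential of $X$. $\|\nabla X(p)\|_g$ is the operator norm of the linear map $\nabla X(p):(T_pM,\|\cdot\|_g)\to(T_pM,\|\cdot\|_g)$, $Y_p\mapsto\nabla_{Y_p}X$. $\mathrm{Fl}^X$ denotes the (maximal local) flow of $X$, i.e. $t\mapsto\mathrm{Fl}^X_t(p)$ is the maximal integral curve of $X$ with value $p$ at $t=0$; saying that $\mathrm{Fl}^X$ is defined on $[0,T]\times A$ means that $\mathrm{Fl}^X_t(p)$ exists for all $t\in[0,T]$ and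 $p\in A$, and $\mathrm{Fl}^X([0,T]\times A)=\{\mathrm{Fl}^X_t(p): t\in[0,T],\,p\in A\}$. $X$ is complete if all its integral curves are defined for all $t\in\mathbb{R}$. *)

(* Defs.v *)
From HB Require Import structures.
From mathcomp Require Import all_boot all_order all_algebra.
From mathcomp Require Import all_classical all_reals all_analysis.
Set Implicit Arguments.
Unset Strict Implicit.
Unset Printing Implicit Defensive.
Import Order.TTheory GRing.Theory Num.Theory numFieldNormedType.Exports.
Local Open Scope classical_set_scope.
Local Open Scope ring_scope.

(* Vectors are row vectors, so a linear map acts by
   v |-> v *m A; the library's [jacobian] follows the same convention. *)

Section EuclideanSmoothness.
Context {R : realType} {n : nat}.

Definition partial (a : 'I_n) (f : 'rV[R]_n -> R) (x : 'rV[R]_n) : R :=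
  'D_(delta_mx 0 a) f x.

(* Meant for open U. *)
Fixpoint Ck (k : nat) (U : set 'rV[R]_n) (f : 'rV[R]_n -> R) : Prop :=
  match k with
  | 0 => forall x, U x -> {for x, continuous f}
  | k'.+1 => (forall x, U x -> differentiable f x) /\
             forall a, Ck k' U (partial a f)
  end.

Definition smooth_on (U : set 'rV[R]_n) (f : 'rV[R]_n -> R) : Prop :=
  forall k, Ck k U f.

End EuclideanSmoothness.

(* Charts are total functions; [cmap] and [cinv] are only meaningful on [cdom]
   and on its image.  Both sets being open, continuity may be tested in the
   ambient spaces. *)
Record chart (R : realType) (n : nat) (M : topologicalType) := Chart {
  cdom : set M;
  cmap : M -> 'rV[R]_n;
  cinv : 'rV[R]_n -> M;
  cdom_open : open cdom;
  cimg_open : open (cmap @` cdom);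
  cmapK : forall p, cdom p -> cinv (cmap p) = p;
  cmap_continuous : forall p, cdom p -> {for p, continuous cmap};
  cinv_continuous : forall x, (cmap @` cdom) x -> {for x, continuous cinv}
}.

Definition overlap (R : realType) (n : nat) (M : topologicalType)
    (f h : chart R n M) : set 'rV[R]_n := cmap f @` (cdom f `&` cdom h).

Definition transition (R : realType) (n : nat) (M : topologicalType)
    (f h : chart R n M) : 'rV[R]_n -> 'rV[R]_n := cmap h \o cinv f.

(* Smooth n-manifold, the smooth structure being given by a smooth atlas.
   [chart_at p] selects one chart around p; every notion evaluated in it below
   is independent of this choice. *)
Record manifold (R : realType) (n : nat) := Manifold {
  mcarrier :> topologicalType;
  mhausdorff : hausdorff_space mcarrier;
  msecond_countable : @second_countable mcarrier;
  cidx : Type;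
  atlas : cidx -> chart R n mcarrier;
  atlas_smooth : forall (i j : cidx) (k : 'I_n),
    smooth_on (overlap (atlas i) (atlas j))
              (fun x => transition (atlas i) (atlas j) x 0 k);
  chart_at : mcarrier -> cidx;
  chart_atP : forall p, cdom (atlas (chart_at p)) p
}.

Section Geometry.
Context {R : realType} {n : nat}.
Variable M : manifold R n.

Definition mdom (i : cidx M) : set M := cdom (atlas i).
Definition mmap (i : cidx M) : M -> 'rV[R]_n := cmap (atlas i).
Definition mimg (i : cidx M) : set 'rV[R]_n := mmap i @` mdom i.
Definition mtrans (i j : cidx M) : 'rV[R]_n -> 'rV[R]_n :=
  transition (atlas i) (atlas j).

(* [gcoef i x] is the matrix (g_ab) at the point of coordinates x in chart i. *)
Record metric := Metric {
  gcoef : cidx M -> 'rV[R]_n -> 'M[R]_n;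
  gcoef_smooth : forall i a b, smooth_on (mimg i) (fun x => gcoef i x a b);
  gcoef_sym : forall i x, mimg i x -> (gcoef i x)^T = gcoef i x;
  gcoef_posdef : forall i x (v : 'rV[R]_n), mimg i x -> v != 0 ->
    0 < (v *m gcoef i x *m v^T) 0 0;
  gcoef_change : forall i j x, overlap (atlas i) (atlas j) x ->
    gcoef i x = jacobian (mtrans i j) x *m gcoef j (mtrans i j x)
                *m (jacobian (mtrans i j) x)^T
}.

Record vector_field := VectorField {
  xcoef : cidx M -> 'rV[R]_n -> 'rV[R]_n;
  xcoef_smooth : forall i a, smooth_on (mimg i) (fun x => xcoef i x 0 a);
  xcoef_change : forall i j x, overlap (atlas i) (atlas j) x ->
    xcoef j (mtrans i j x) = xcoef i x *m jacobian (mtrans i j) x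
}.

Implicit Types (g : metric) (X : vector_field) (c : R -> M) (J : set R).

Definition gnorm g (i : cidx M) (x v : 'rV[R]_n) : R :=
  Num.sqrt ((v *m gcoef g i x *m v^T) 0 0).

(* Christoffel symbol \Gamma^k_{ab} of the Levi-Civita connection. *)
Definition christoffel g (i : cidx M) (x : 'rV[R]_n) (k a b : 'I_n) : R :=
  2^-1 * \sum_(l < n) invmx (gcoef g i x) k l *
    (partial a (fun y => gcoef g i y b l) x
     + partial b (fun y => gcoef g i y a l) x
     - partial l (fun y => gcoef g i y a b) x).

(* Matrix of Y |-> \nabla_Y X, i.e. (\nabla_Y X)^k = \sum_a Y^a nabla_{a k}. *)
Definition nabla g X (i : cidx M) (x : 'rV[R]_n) : 'M[R]_n :=
  \matrix_(a, k) (partial a (fun y => xcoef X i y 0 k) x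
                  + \sum_(b < n) christoffel g i x k a b * xcoef X i x 0 b).

Definition nabla_norm g X (p : M) : R :=
  let i := chart_at p in let x := mmap i p in
  sup [set gnorm g i x (Y *m nabla g X i x) |
       Y in [set Y : 'rV[R]_n | gnorm g i x Y <= 1]].

Definition curve_C1_on c J : Prop :=
  open J /\ forall t, J t -> {for t, continuous c} /\
    forall i, mdom i (c t) ->
      derivable (mmap i \o c) t 1 /\
      {for t, continuous (derive1 (mmap i \o c))}.

Definition curve_C1_segment c (a b : R) : Prop :=
  exists J c', [/\ `[a, b] `<=` J, curve_C1_on c' J &
                   forall t, a <= t <= b -> c t = c' t].

(* The subdivision is a = t_0 < t_1 < ... < t_m = b with s = [t_1; ...; t_m]. *)
Definition piecewise_C1 c (a b : R) : Prop :=
  {within `[a, b], continuous c} /\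
  exists s : seq R, [/\ path <%R a s, last a s = b &
    forall k, (k < size s)%N ->
      curve_C1_segment c (nth a (a :: s) k) (nth a s k)].

(* At the finitely many break points the value is irrelevant for [curve_length]. *)
Definition speed g c (t : R) : R :=
  let i := chart_at (c t) in
  gnorm g i (mmap i (c t)) (derive1 (mmap i \o c) t).

Definition curve_length g c (a b : R) : R :=
  \int[@lebesgue_measure R]_(t in `[a, b]) speed g c t.

Definition rdist g (p q : M) : R :=
  inf [set l | exists c a b,
    [/\ a <= b, piecewise_C1 c a b, c a = p, c b = q & l = curve_length g c a b]].

(* The geodesic equation x''^k + \Gamma^k_{ab} x'^a x'^b = 0 in every chart. *)
Definition geodesic_on g c J : Prop :=
  open J /\ forall t, J t -> {for t, continuous c} /\
    forall i, mdom i (c t) ->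
      let x := mmap i \o c in
      [/\ derivable x t 1, derivable (derive1 x) t 1 &
        forall k : 'I_n, derive1 (derive1 x) t 0 k =
          - \sum_(a < n) \sum_(b < n)
              christoffel g i (x t) k a b * derive1 x t 0 a * derive1 x t 0 b].

Definition geodesically_complete g : Prop :=
  forall c J, is_interval J -> J !=set0 -> geodesic_on g c J ->
    exists c', geodesic_on g c' setT /\ forall t, J t -> c' t = c t.

Definition minimizing_geodesic_segment g (p q : M) (S : set M) : Prop :=
  exists c a b J,
    a <= b /\ `[a, b] `<=` J /\ is_interval J /\ geodesic_on g c J /\
    c a = p /\ c b = q /\ curve_length g c a b = rdist g p q /\ S = c @` `[a, b].

Definition integral_curve_on X c J : Prop :=
  [/\ open J, is_interval J & forall t, J t -> {for t, continuous c} /\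
    forall i, mdom i (c t) ->
      is_derive t 1 (mmap i \o c) (xcoef X i (mmap i (c t)))].

Definition maximal_integral_curve X (p : M) c J : Prop :=
  [/\ integral_curve_on X c J, J 0, c 0 = p &
    forall c' J', integral_curve_on X c' J' -> J `<=` J' ->
      (forall t, J t -> c' t = c t) -> J' = J].

Definition flow_graph X (t : R) (p y : M) : Prop :=
  exists c J, [/\ maximal_integral_curve X p c J, J t & y = c t].

Definition flow_defined X (t : R) (p : M) : Prop :=
  exists y, flow_graph X t p y.

(* [flow X t p] is p, a junk value, where the flow is not defined. *)
Definition flow X (t : R) (p : M) : M := xget p [set y | flow_graph X t p y].

Definition flow_image X (T : R) (S : set M) : set M :=
  [set y | exists t p, [/\ 0 <= t <= T, S p, flow_defined X t p
                         & y = flow X t p]].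

Definition complete_field X : Prop :=
  forall p, exists c, maximal_integral_curve X p c setT.

Definition CT g X (T : R) (S : set M) : R :=
  sup [set nabla_norm g X p | p in flow_image X T S].

End Geometry.

(* Main.v *)
Require Import Defs.
From HB Require Import structures.
From mathcomp Require Import all_boot all_order all_algebra.
From mathcomp Require Import all_classical all_reals all_analysis.
From mathcomp Require Import measurable_realfun.
From mathcomp Require Import lra ring.
Import Order.TTheory GRing.Theory Num.Theory numFieldNormedType.Exports.
Local Open Scope classical_set_scope.
Local Open Scope ring_scope.

(* For s in [a, b] let x_s be the integral curve through the point c(s) of the
   segment. No differentiability of the flow in the initial point is needed: in a
   chart, w = x_s' - x_s satisfies
     d/dt g(w, w) = 2 g(nabla_w X, w) + o(|w|^2),
   so Gronwall's lemma bounds the length of w at time t by e^((C + eps) t) times its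
   initial length for s' near s. Hence the Riemannian distance from x_s(t) to x_s'(t)
   is at most (1 + o(1)) e^(C t) |c'(s)| |s' - s|. This is an infinitesimal estimate
   at every s; chaining short coordinate segments (Cousin's lemma on [a, b]) turns it
   into a curve from p(t) to q(t) of length at most e^(C t) times that of c, up to an
   arbitrarily small error. Boundedness of the operator norms of nabla X over the flow
   image, without which C would be a junk supremum, and uniqueness of integral curves
   follow from the same local estimate. *)

Set Implicit Arguments.
Unset Strict Implicit.
Unset Printing Implicit Defensive.

(** * Calculus on row vectors *)

(** The bound C is required only along the base curve x_s: whatever happens between x_s and x_s'
    goes into the o(|w|^2) term. So a supremum over the flow image of the segment suffices, although
    the short coordinate segments joining the x_s(t) may leave that image. Four obstacles shape the
    rest. [nabla_norm] and [speed] are computed in a chart selected point by point, which may jump;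
    hence nabla X has to be shown tensorial, which is done on the form g(nabla_y X, z), where the
    inverse metric has disappeared. An integral curve may cross several charts, and coordinate
    differences are invariant only to first order; each change of chart costs a factor e^(e'), and
    Cousin's lemma is applied in time as well, with e' halved at each junction. Continuity of the
    flow in the initial point is an outcome: a bootstrap in the chart shows that curves starting
    nearby stay nearby. Finally, lengths are integrals that may take default values, so a
    concatenated curve carries its measurability and an extended-real length bound along. *)

Section EuclideanCalculus.
Context {R : realType}.

Lemma differentiable_mxP (V : normedModType R) m n (F : V -> 'M[R]_(m, n)) x :
  (forall i j, differentiable (fun y => F y i j) x) -> differentiable F x.
Proof.
move=> dF.
have -> : F = \sum_(i < m) \sum_(j < n)
    (fun y => F y i j *: (delta_mx i j : 'M[R]_(m, n))).
  apply/funext => y; rewrite fct_sumE [LHS]matrix_sum_delta.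
  by apply: eq_bigr => i _; rewrite fct_sumE.
by apply: differentiable_sum => i; apply: differentiable_sum => j;
  exact: differentiableZl.
Qed.

Context {n : nat}.
Implicit Types (f : 'rV[R]_n -> R) (U : set 'rV[R]_n) (x v : 'rV[R]_n).

Lemma derive_partial f x v : differentiable f x ->
  'D_v f x = \sum_a v 0 a * partial a f x.
Proof.
move=> df; rewrite deriveE// {1}[v]row_sum_delta raddf_sum /=.
by apply: eq_bigr => a _; rewrite linearZ /partial deriveE.
Qed.

Lemma is_derive_along (V : normedModType R) (W : normedModType R)
    (f : V -> W) (c : R -> V) (t : R) (v : V) :
  differentiable f (c t) -> is_derive t 1 c v ->
  is_derive t 1 (f \o c) ('D_v f (c t)).
Proof.
move=> df [dc cE].
have dc' : differentiable c t by apply/derivable1_diffP.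
apply: DeriveDef; first by apply/derivable1_diffP; exact: differentiable_comp.
rewrite deriveE; last exact: differentiable_comp.
by rewrite diff_comp// deriveE// -cE deriveE.
Qed.

Lemma is_derive_line x v (t : R) : is_derive t 1 (fun s : R => x + s *: v) v.
Proof.
have dl : is_derive t 1 ( *:%R^~ v : R -> 'rV[R]_n) v.
  by apply: DeriveDef; [exact/diff_derivable|rewrite deriveE// diff_val scale1r].
by have := @is_deriveD _ _ _ (cst x) _ t 1 _ _ (is_derive_cst x t 1) dl; rewrite add0r.
Qed.

Lemma mean_value_line f x v :
  (forall t : R, 0 <= t <= 1 -> differentiable f (x + t *: v)) ->
  exists2 t : R, 0 <= t <= 1 & f (x + v) - f x = 'D_v f (x + t *: v).
Proof.
move=> df.
pose c : R -> 'rV[R]_n := fun t => x + t *: v.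
have dc (t : R) : is_derive t 1 c v by exact: is_derive_line.
have d (t : R) : 0 <= t <= 1 -> is_derive t 1 (f \o c) ('D_v f (c t)).
  by move=> t01; apply: is_derive_along => //; exact: df.
have [t|t|t] := @MVT_segment R (f \o c) (fun t => 'D_v f (c t)) 0 1 ler01.
- by rewrite in_itv/= => /andP[/ltW t0 /ltW t1]; apply: d; rewrite t0.
- apply: derivable_within_continuous => {}t; rewrite in_itv/= => t01.
  by have [] := d t t01.
- rewrite in_itv/= => t01; rewrite /c/= scale1r scale0r addr0 subr0 mulr1 => E.
  by exists t.
Qed.

Lemma smooth_differentiable U f x : smooth_on U f -> U x -> differentiable f x.
Proof. by move=> fs Ux; have [fd _] := fs 1%N; exact: fd. Qed.

Lemma smooth_partial U f a : smooth_on U f -> smooth_on U (partial a f).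
Proof. by move=> fs k; have [_ fa] := fs k.+1; exact: fa. Qed.

Lemma smooth_continuous U f x : smooth_on U f -> U x -> {for x, continuous f}.
Proof. by move=> fs Ux; exact: (fs 0%N). Qed.

Lemma mx_entry_le_norm m (w : 'M[R]_(m, n)) i j : `|w i j| <= `|w|.
Proof.
rewrite [leRHS]/Num.Def.normr/= mx_normrE.
exact: (le_bigmax _ (fun ij => `|w ij.1 ij.2|) (i, j)).
Qed.

Lemma diff_littleo (V W : normedModType R) (f : V -> W) (x : V) :
  differentiable f x -> forall e : R, 0 < e ->
  exists2 d : R, 0 < d &
    forall k, `|k| < d -> `|f (x + k) - f x - 'd f x k| <= e * `|k|.
Proof.
move=> /diff_locallyP[_ /eqaddoP df] e e0.
have /nbhs_ballP[d d0 Hd] := df _ e0.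
exists d => // k kd.
have := Hd k; rewrite -ball_normE/= sub0r normrN => /(_ kd).
by rewrite !fctE /= [k + x]addrC opprD addrA.
Qed.

Lemma derive_translate (V W : normedModType R) (f : V -> W) (k x w : V) :
  'D_w (fun y => f (y + k)) x = 'D_w f (x + k).
Proof.
rewrite /derive; set A := (fun h : R => _); set B := (fun h : R => _).
by suff -> : A = B by []; apply/funext => h; rewrite /A /B /= addrA.
Qed.

Lemma differentiable_translate (V W : normedModType R) (f : V -> W) (k x : V) :
  differentiable f (x + k) -> differentiable (fun y => f (y + k)) x.
Proof.
move=> df; apply: (@differentiable_comp _ _ _ _ (fun y => y + k) f); last exact: df.
by apply: differentiableD; [exact: ex_diff|exact: differentiable_cst].
Qed.

Lemma derive_scaledir (V : normedModType R) (f : V -> R) (x v : V) (h : R) :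
  differentiable f x -> 'D_(h *: v) f x = h * 'D_v f x.
Proof. by move=> df; rewrite deriveE// deriveE// linearZ. Qed.

(* The second difference of f is symmetric in u and v, whence [derive_sym]. *)
Lemma second_difference f x u v :
  (\forall y \near x, differentiable f y) -> differentiable ('D_u f) x ->
  forall e : R, 0 < e -> exists2 d : R, 0 < d & forall h : R, 0 < h < d ->
    `|f (x + h *: u + h *: v) - f (x + h *: u) - (f (x + h *: v) - f x)
      - h ^+ 2 * 'D_v ('D_u f) x| <= e * h ^+ 2.
Proof.
move=> /nbhs_ballP[r r0 df] dDu e e0.
(* The increments [k1] and [k2] below have norms adding up to at most h (2|u| + |v|); the 1 keeps K
   positive. *)
set K := 2 * `|u| + `|v| + 1.
have K0 : 0 < K by rewrite ltr_wpDl// addr_ge0// mulr_ge0.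
have [d d0 Hd] := diff_littleo dDu (divr_gt0 e0 K0).
exists (Num.min d r / K); first by rewrite divr_gt0// lt_min d0.
move=> h /andP[h0]; rewrite ltr_pdivlMr// lt_min => /andP[hKd hKr].
have small (s t : R) : 0 <= s <= 1 -> 0 <= t <= 1 ->
    `|s *: (h *: u) + t *: (h *: v)| <= h * (`|u| + `|v|).
  move=> /andP[s0 s1] /andP[t0 t1]; apply: le_trans (ler_normD _ _) _.
  rewrite !normrZ !ger0_norm// ?(ltW h0)// mulrDr lerD//.
    by rewrite ler_piMl// mulr_ge0// ltW.
  by rewrite ler_piMl// mulr_ge0// ltW.
have hK : h * (`|u| + `|v|) < h * K.
  by rewrite ltr_pM2l// /K; have := normr_ge0 u; lra.
have inr (s t : R) : 0 <= s <= 1 -> 0 <= t <= 1 ->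
    differentiable f (x + s *: (h *: u) + t *: (h *: v)).
  move=> s01 t01; apply: df; rewrite -ball_normE/= opprD opprD !addrA subrr add0r.
  by rewrite -opprD normrN (le_lt_trans (small _ _ s01 t01))// (lt_trans hK).
(* The mean value theorem for F in direction u leaves two values of ['D_u f]. Both are expanded at
   x, so differentiability of ['D_u f] at this single point is enough. *)
pose F y := f (y + h *: v) - f y.
have dF (t : R) : 0 <= t <= 1 -> differentiable F (x + t *: (h *: u)).
  move=> t01; apply: differentiableB.
    apply: differentiable_translate.
    by rewrite -[h *: v in X in differentiable _ X]scale1r; apply: inr => //; rewrite ler01 lexx.
  rewrite -[X in differentiable _ X]addr0 -[0 in X in differentiable _ X](scale0r (h *: v)).
  by apply: inr => //; rewrite lexx ler01.
have [t t01 Ft] := mean_value_line dF.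
have -> : f (x + h *: u + h *: v) - f (x + h *: u) - (f (x + h *: v) - f x) =
  F (x + h *: u) - F x by [].
have dF0 := dF _ t01; have /andP[t0 t1] := t01.
have d1 : differentiable f (x + t *: (h *: u)).
  by rewrite -[X in differentiable _ X]addr0 -[0 in X in differentiable _ X](scale0r (h *: v)); apply: inr => //; rewrite lexx ler01.
have d2 : differentiable f (x + t *: (h *: u) + h *: v).
  by rewrite -[h *: v]scale1r; apply: inr => //; rewrite ler01 lexx.
have -> : F (x + h *: u) - F x =
    h * ('D_u f (x + t *: (h *: u) + h *: v) - 'D_u f (x + t *: (h *: u))).
  rewrite Ft deriveB; last 2 first.
  - exact/diff_derivable/differentiable_translate.
  - exact/diff_derivable.
  by rewrite derive_translate (derive_scaledir _ _ d1) (derive_scaledir _ _ d2) mulrBr.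
set g := 'D_u f in dDu Hd *.
set k1 := t *: (h *: u); set k2 := k1 + h *: v.
have nk1 : `|k1| <= h * `|u|.
  by rewrite /k1 !normrZ (ger0_norm t0) (gtr0_norm h0) ler_piMl// mulr_ge0// ltW.
have nk2 : `|k2| <= h * (`|u| + `|v|).
  rewrite mulrDr (le_trans (ler_normD _ _))// lerD//.
  by rewrite normrZ gtr0_norm.
have nk1d : `|k1| < d.
  rewrite (le_lt_trans nk1)// (lt_trans _ hKd)// ltr_pM2l// /K.
  by have := normr_ge0 u; have := normr_ge0 v; lra.
have nk2d : `|k2| < d by rewrite (le_lt_trans nk2)// (lt_trans hK).
have {nk1d}H1 := Hd _ nk1d; have {nk2d}H2 := Hd _ nk2d.
rewrite -addrA -/k2.
have -> : h * (g (x + k2) - g (x + k1)) - h ^+ 2 * 'D_v g x =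
    h * ((g (x + k2) - g x - 'd g x k2) - (g (x + k1) - g x - 'd g x k1)).
  have -> : 'd g x k2 = 'd g x k1 + h * 'D_v g x.
    by rewrite /k2 linearD; congr (_ + _); rewrite linearZ deriveE.
  by move: (g _) (g _) (g _) ('d g x k1) ('D_v g x) => *; ring.
rewrite normrM gtr0_norm// expr2 mulrCA ler_pM2l//.
apply: le_trans (ler_normB _ _) _; apply: le_trans (lerD H2 H1) _.
rewrite -mulrDr -mulrA ler_pM2l// ler_pdivrMl//.
apply: le_trans (lerD nk2 nk1) _.
rewrite -mulrDr mulrC ler_pM2r// /K.
by lra.
Qed.

Lemma derive_sym f x u v :
  (\forall y \near x, differentiable f y) ->
  differentiable ('D_u f) x -> differentiable ('D_v f) x ->
  'D_v ('D_u f) x = 'D_u ('D_v f) x.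
Proof.
move=> df du dv; apply/eqP; rewrite -subr_eq0 -normr_le0; apply/ler_addgt0Pl => e e0.
rewrite addr0.
have e20 : 0 < e / 2 by rewrite divr_gt0.
have [d1 d10 H1] := second_difference v df du e20.
have [d2 d20 H2] := second_difference u df dv e20.
pose h := Num.min d1 d2 / 2.
have h0 : 0 < h by rewrite divr_gt0// lt_min d10.
have hm : h < Num.min d1 d2 by rewrite ltr_pdivrMr// mulr2n mulrDr mulr1 ltrDl lt_min d10.
have {}H1 := H1 h; have {}H2 := H2 h.
move: H1 H2; rewrite h0 (lt_le_trans hm)// ?ge_min ?lexx// (lt_le_trans hm)// ?ge_min ?lexx ?orbT//.
move=> /(_ isT) H1 /(_ isT) H2.
have h20 : 0 < h ^+ 2 by rewrite exprn_gt0.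
rewrite -(ler_pM2r h20) -{1}(gtr0_norm h20) -normrM.
have := lerD H1 H2; rewrite -mulrDl -splitr; apply: le_trans.
apply: le_trans (ler_normB _ _); rewrite (addrAC x (h *: v)).
move: (f _) (f _) (f _) (f _) ('D_v ('D_u f) x) ('D_u ('D_v f) x) => A B C D P Q.
by rewrite -[X in _ <= X]normrN le_eqVlt; apply/orP; left; apply/eqP; congr `|_|; ring.
Qed.

End EuclideanCalculus.

(** * Calculus of matrix-valued maps and the covariant differential with lowered index *)

Section MatrixCalculus.
Context {R : realType}.

Lemma derivable_mulmx (V : normedModType R) m n p (P : V -> 'M[R]_(m, n))
    (Q : V -> 'M[R]_(n, p)) (x v : V) :
  derivable P x v -> derivable Q x v -> is_derive x v (fun y => P y *m Q y)
    ('D_v P x *m Q x + P x *m 'D_v Q x).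
Proof.
move=> dP dQ.
have dP' i j : derivable (fun y => P y i j) x v by move/derivable_mxP : dP; exact.
have dQ' i j : derivable (fun y => Q y i j) x v by move/derivable_mxP : dQ; exact.
have E i k : is_derive x v (fun y => (P y *m Q y) i k)
    (('D_v P x *m Q x + P x *m 'D_v Q x) i k).
  have -> : (fun y => (P y *m Q y) i k) =
      \sum_(j < n) ((fun y => P y i j) * (fun y => Q y j k)).
    by apply/funext => y; rewrite fct_sumE mxE.
  apply: is_derive_eq.
    by apply: is_derive_sum => j; apply: is_deriveM; exact: derivableP.
  rewrite !mxE -big_split/=; apply: eq_bigr => j _.
  rewrite !derive_mx// !mxE -![_ *: _]/(_ * _).
  by rewrite addrC (mulrC (Q x j k)).
apply: DeriveDef; first by apply/derivable_mxP => i k; have [] := E i k.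
rewrite derive_mx; last by apply/derivable_mxP => i k; have [] := E i k.
by apply/matrixP => i k; rewrite mxE; have [_ ->] := E i k.
Qed.

Lemma derivable_trmx (V : normedModType R) m n (P : V -> 'M[R]_(m, n)) (x v : V) :
  derivable P x v -> is_derive x v (fun y => (P y)^T) ('D_v P x)^T.
Proof.
move=> dP; have E i j : (fun y => (P y)^T i j) = (fun y => P y j i).
  by apply/funext => y; rewrite mxE.
have dT : derivable (fun y => (P y)^T) x v.
  by apply/derivable_mxP => i j; rewrite E; move/derivable_mxP : dP; exact.
by apply: DeriveDef => //; rewrite !derive_mx//; apply/matrixP => i j; rewrite !mxE E.
Qed.

Lemma derive_chain (V W Z : normedModType R) (phi : V -> W) (F : W -> Z) (x v : V) :
  differentiable phi x -> differentiable F (phi x) ->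
  is_derive x v (F \o phi) ('D_('D_v phi x) F (phi x)).
Proof.
move=> dp dF; have d : differentiable (F \o phi) x by exact: differentiable_comp.
apply: DeriveDef; first exact: diff_derivable.
by rewrite !deriveE// diff_comp.
Qed.

Context {n : nat}.
Implicit Types (U : set 'rV[R]_n).

Definition smooth_mx m p U (F : 'rV[R]_n -> 'M[R]_(m, p)) :=
  forall i j, smooth_on U (fun y => F y i j).

Lemma smooth_mx_differentiable m p U (F : 'rV[R]_n -> 'M[R]_(m, p)) x :
  smooth_mx U F -> U x -> differentiable F x.
Proof.
by move=> sF Ux; apply: differentiable_mxP => i j; exact: smooth_differentiable (sF i j) Ux.
Qed.

(** The Jacobian written with partial derivatives, so that smoothness passes to it entry by entry;
    [jacobian_pjac] identifies it with [jacobian]. *)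
Definition pjac (phi : 'rV[R]_n -> 'rV[R]_n) (x : 'rV[R]_n) : 'M[R]_n :=
  \matrix_(a, b) partial a (fun y => phi y 0 b) x.

Lemma pjacE phi x (v : 'rV[R]_n) : differentiable phi x ->
  'D_v phi x = v *m pjac phi x.
Proof.
move=> dp; have dphi i j : differentiable (fun y => phi y i j) x.
  apply: (@differentiable_comp _ _ _ _ phi (fun z => z i j)) => //.
  exact: differentiable_coord.
rewrite derive_mx; last exact: diff_derivable.
apply/matrixP => i j; rewrite !mxE derive_partial//.
by rewrite (ord1 i); apply: eq_bigr => a _; rewrite mxE.
Qed.

Lemma jacobian_pjac (phi : 'rV[R]_n -> 'rV[R]_n) x : differentiable phi x ->
  jacobian phi x = pjac phi x.
Proof.
by move=> dp; apply/row_matrixP => i; rewrite !rowE -deriveEjacobian// pjacE.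
Qed.

Lemma smooth_mx_pjac U phi : smooth_mx U phi -> smooth_mx U (pjac phi).
Proof.
move=> sp a b.
have -> : (fun y => pjac phi y a b) = partial a (fun y => phi y 0 b).
  by apply/funext => y; rewrite mxE.
exact: smooth_partial.
Qed.

(** Both sides are the second derivative of phi in the directions u and v, so this is [derive_sym]
    for each component. *)
Lemma pjac_sym U phi x (u v : 'rV[R]_n) : open U -> smooth_mx U phi -> U x ->
  u *m 'D_v (pjac phi) x = v *m 'D_u (pjac phi) x.
Proof.
move=> oU sp Ux.
have Un : \forall y \near x, U y by exact: open_nbhs_nbhs.
have dP w : derivable (pjac phi) x w.
  exact/diff_derivable/(smooth_mx_differentiable (smooth_mx_pjac sp)).
have E (w1 w2 : 'rV[R]_n) b : (w1 *m 'D_w2 (pjac phi) x) 0 b =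
    \sum_a \sum_c w1 0 a * (w2 0 c * partial c (partial a (fun y => phi y 0 b)) x).
  rewrite mxE; apply: eq_bigr => a _; rewrite -mulr_sumr derive_mx// mxE.
  have -> : (fun y => pjac phi y a b) = partial a (fun y => phi y 0 b).
    by apply/funext => y; rewrite mxE.
  rewrite derive_partial//.
  exact: (smooth_differentiable (smooth_partial a (sp 0 b)) Ux).
have S a c b : partial c (partial a (fun y => phi y 0 b)) x =
    partial a (partial c (fun y => phi y 0 b)) x.
  apply: derive_sym.
  - by near=> y; apply: (smooth_differentiable (sp 0 b)); near: y.
  - exact: (smooth_differentiable (smooth_partial a (sp 0 b)) Ux).
  - exact: (smooth_differentiable (smooth_partial c (sp 0 b)) Ux).
apply/rowP => b.
apply: etrans (E u v b) _.
apply: etrans _ (esym (E v u b)).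
rewrite [LHS]exchange_big /=.
apply: eq_bigr => c _.
apply: eq_bigr => a _.
by rewrite S mulrCA.
Unshelve. all: by end_near. Qed.

Lemma trmx11 (A : 'M[R]_1) : A^T = A.
Proof. by rewrite [A]mx11_scalar tr_scalar_mx. Qed.

(** Here P is the Jacobian and A the metric matrix in the new chart; [Qx], [Qy], [Qz] are the
    derivatives of P along X, y, z, and [B1], [B2], [B3] those of A along the images of y, X, z. The
    three symmetry hypotheses make all terms with a derivative of P cancel. *)
Lemma lowered_alg (P A B1 B2 B3 Qx Qy Qz : 'M[R]_n) (dX dX' X y z : 'rV[R]_n) :
  A^T = A -> dX *m P = dX' - X *m Qy ->
  y *m Qx = X *m Qy -> z *m Qy = y *m Qz -> z *m Qx = X *m Qz ->
  dX *m (P *m A *m P^T) *m z^T + 2^-1 *: (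
     X *m (Qy *m A *m P^T + P *m B1 *m P^T + P *m A *m Qy^T) *m z^T
   + y *m (Qx *m A *m P^T + P *m B2 *m P^T + P *m A *m Qx^T) *m z^T
   - y *m (Qz *m A *m P^T + P *m B3 *m P^T + P *m A *m Qz^T) *m X^T) =
  dX' *m A *m (z *m P)^T + 2^-1 *: (
    X *m P *m B1 *m (z *m P)^T + y *m P *m B2 *m (z *m P)^T
    - y *m P *m B3 *m (X *m P)^T).
Proof.
move=> As dXP yx zy zx.
have E1 : dX *m (P *m A *m P^T) *m z^T
   = dX' *m A *m (z *m P)^T - X *m Qy *m A *m (z *m P)^T.
  by rewrite trmx_mul !mulmxA dXP !mulmxBl.
have E2 (Q B : 'M[R]_n) (w t : 'rV[R]_n) :
   w *m (Q *m A *m P^T + P *m B *m P^T + P *m A *m Q^T) *m t^T =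
     w *m Q *m A *m (t *m P)^T + w *m P *m B *m (t *m P)^T
   + t *m Q *m A *m (w *m P)^T.
  rewrite !mulmxDr !mulmxDl !trmx_mul !mulmxA; congr (_ + _).
  by rewrite -[LHS]trmx11 !trmx_mul !trmxK As -!mulmxA.
rewrite E1 !E2 yx zy zx.
move: (dX' *m A *m _) (X *m Qy *m A *m _) (X *m Qz *m A *m _)
  (y *m Qz *m A *m _) (X *m P *m _ *m _) (y *m P *m _ *m _) (y *m P *m _ *m _).
move=> a b c d e1 e2 e3; apply/matrixP => i j; rewrite !mxE.
move: (a i j) (b i j) (c i j) (d i j) (e1 i j) (e2 i j) (e3 i j) => *.
by field.
Qed.

(* The 1x1 matrix of g(nabla_y X, z): half of L_X g + d(X^flat), a combination of
   Lie and exterior derivatives. It needs neither Christoffel symbols nor the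
   inverse of g, and only the symmetry of second derivatives to be tensorial. *)
Definition lowered (G : 'rV[R]_n -> 'M[R]_n) (X : 'rV[R]_n -> 'rV[R]_n)
    (x y z : 'rV[R]_n) : 'M[R]_1 :=
  'D_y X x *m G x *m z^T + 2^-1 *: (X x *m 'D_y G x *m z^T
    + y *m 'D_(X x) G x *m z^T - y *m 'D_z G x *m (X x)^T).

(** The transformation rules of G and X are assumed on all of U because they get differentiated.
    This produces second derivatives of phi, which [lowered_alg] cancels. *)
Lemma lowered_change U phi (G G' : 'rV[R]_n -> 'M[R]_n)
    (X X' : 'rV[R]_n -> 'rV[R]_n) (x y z : 'rV[R]_n) :
  open U -> smooth_mx U phi -> U x ->
  differentiable G x -> differentiable G' (phi x) ->
  differentiable X x -> differentiable X' (phi x) ->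
  (forall u, U u -> G u = pjac phi u *m G' (phi u) *m (pjac phi u)^T) ->
  (forall u, U u -> X' (phi u) = X u *m pjac phi u) ->
  (G' (phi x))^T = G' (phi x) ->
  lowered G X x y z = lowered G' X' (phi x) (y *m pjac phi x) (z *m pjac phi x).
Proof.
move=> oU sp Ux dG dG' dX dX' GE XE Gs.
have Un : \forall u \near x, U u by exact: open_nbhs_nbhs.
have dphi : differentiable phi x := smooth_mx_differentiable sp Ux.
have dPx : differentiable (pjac phi) x := smooth_mx_differentiable (smooth_mx_pjac sp) Ux.
have dP v : derivable (pjac phi) x v by exact: diff_derivable.
pose Q v := 'D_v (pjac phi) x; pose P := pjac phi x.
have symQ u v : u *m Q v = v *m Q u by exact: (pjac_sym _ _ oU sp Ux).
have DG v : 'D_v G x = Q v *m G' (phi x) *m P^T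
    + P *m 'D_(v *m P) G' (phi x) *m P^T + P *m G' (phi x) *m (Q v)^T.
  have -> : 'D_v G x = 'D_v (fun u => (pjac phi u *m (G' \o phi) u) *m (pjac phi u)^T) x.
    by apply: near_eq_derive; near=> u; apply: GE; near: u.
  have c1 := derive_chain v dphi dG'; rewrite (pjacE v dphi) in c1.
  have [d1 e1] := c1.
  have [d2 e2] := derivable_mulmx (dP v) d1.
  have [d3 e3] := derivable_trmx (dP v).
  have [_ ->] := derivable_mulmx d2 d3.
  by rewrite e3 e2 e1 /= !mulmxDl.
have DX v : 'D_v X x *m P = 'D_(v *m P) X' (phi x) - X x *m Q v.
  have c1 := derive_chain v dphi dX'; rewrite (pjacE v dphi) in c1.
  have [_ <-] := c1.
  have -> : 'D_v (X' \o phi) x = 'D_v (fun u => X u *m pjac phi u) x.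
    by apply: near_eq_derive; near=> u; apply: XE; near: u.
  have [_ ->] := derivable_mulmx (diff_derivable dX : derivable X x v) (dP v).
  by rewrite addrK.
rewrite /lowered XE// !DG GE// -!/P.
apply: lowered_alg => //; exact: symQ.
Unshelve. all: by end_near. Qed.

End MatrixCalculus.

(** * Positive definite forms *)

Section QuadraticForms.
Context {R : realType} {n : nat}.
Implicit Types (G H : 'M[R]_n) (u v w : 'rV[R]_n).

Definition qf G v w : R := (v *m G *m w^T) 0 0.

Definition posdef G := G^T = G /\ forall v, v != 0 -> 0 < qf G v v.

Lemma qfE G v w : qf G v w = \sum_a \sum_b v 0 a * w 0 b * G a b.
Proof.
rewrite /qf mxE exchange_big; apply: eq_bigr => b _; rewrite !mxE mulr_suml.
by apply: eq_bigr => a _; rewrite mulrAC.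
Qed.

Lemma qfDl G u v w : qf G (u + v) w = qf G u w + qf G v w.
Proof. by rewrite /qf !mulmxDl mxE. Qed.

Lemma qfDr G u v w : qf G w (u + v) = qf G w u + qf G w v.
Proof. by rewrite /qf linearD/= mulmxDr mxE. Qed.

Lemma qfZl G a v w : qf G (a *: v) w = a * qf G v w.
Proof. by rewrite /qf -!scalemxAl mxE. Qed.

Lemma qfZr G a v w : qf G v (a *: w) = a * qf G v w.
Proof. by rewrite /qf linearZ/= -scalemxAr mxE. Qed.

Lemma qfC G v w : G^T = G -> qf G v w = qf G w v.
Proof. by move=> Gs; rewrite /qf -mulmxA -{1}Gs -trmx_mul -{1}[v]trmxK -trmx_mul mxE. Qed.

Lemma qfB G H v w : qf (G - H) v w = qf G v w - qf H v w.
Proof. by rewrite /qf mulmxBr mulmxBl !mxE. Qed.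

Lemma posdef_ge0 G v : posdef G -> 0 <= qf G v v.
Proof.
move=> [_ Gp]; have [->|v0] := eqVneq v 0; last exact/ltW/Gp.
by rewrite /qf !mul0mx mxE.
Qed.

Lemma qf_cauchy G v w : posdef G -> qf G v w ^+ 2 <= qf G v v * qf G w w.
Proof.
move=> pG; have Gs := pG.1.
have [->|w0] := eqVneq w 0.
  by rewrite /qf trmx0 !mulmx0 mxE expr0n mulr0.
have ww : 0 < qf G w w := pG.2 _ w0.
(* The vector is [qf G w w] times the component of v orthogonal to w; the scaling avoids a
   division. *)
have := posdef_ge0 (qf G w w *: v + (- qf G v w) *: w) pG.
rewrite qfDl !qfDr !qfZl !qfZr (qfC w v Gs).
move: (qf G v w) (qf G w w) (qf G v v) ww => a b c b0 H.
have : 0 <= b * (c * b - a ^+ 2) by move: H; congr (0 <= _); ring.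
by rewrite pmulr_rge0// subr_ge0.
Qed.

Lemma posdef_unitmx G : posdef G -> G \in unitmx.
Proof.
move=> [_ Gp]; rewrite -row_free_unit -kermx_eq0; apply/rowV0P => v /sub_kermxP vG.
by apply/eqP/negPn/negP => /Gp; rewrite /qf vG mul0mx mxE ltxx.
Qed.

Lemma norm_mx_le m p (M : 'M[R]_(m, p)) (e : R) : 0 <= e ->
  (forall i j, `|M i j| <= e) -> `|M| <= e.
Proof.
move=> e0 Me; rewrite [leLHS]/Num.Def.normr/= mx_normrE.
by apply: bigmax_le => // -[i j] _; exact: Me.
Qed.

Lemma qf_bound G v w : `|qf G v w| <= n%:R ^+ 2 * `|G| * `|v| * `|w|.
Proof.
rewrite /qf mxE; apply: le_trans (ler_norm_sum _ _ _) _.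
have E b : `|(v *m G) 0 b * w^T b 0| <= n%:R * `|G| * `|v| * `|w|.
  rewrite normrM !mxE ler_pM// ?mx_entry_le_norm//.
  apply: le_trans (ler_norm_sum _ _ _) _.
  apply: (@le_trans _ _ (\sum_(i < n) `|G| * `|v|)).
    by apply: ler_sum => a _; rewrite normrM mulrC ler_pM// mx_entry_le_norm.
  by rewrite sumr_const card_ord -mulrA mulr_natl.
apply: (@le_trans _ _ (\sum_(i < n) (n%:R * `|G| * `|v| * `|w|))).
  by apply: ler_sum => b _; exact: E.
by rewrite sumr_const card_ord -[leLHS]mulr_natl !mulrA expr2.
Qed.

(* By Cauchy-Schwarz, since w_a is the G-product of w and row a of G^-1. *)
Lemma posdef_lower G : posdef G ->
  exists2 k : R, 0 < k & forall w, `|w| ^+ 2 <= k * qf G w w.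
Proof.
move=> pG; have uG := posdef_unitmx pG.
pose r a := row a (invmx G).
pose k : R := 1 + \sum_a qf G (r a) (r a).
have s0 : 0 <= \sum_a qf G (r a) (r a) by apply: sumr_ge0 => a _; exact: posdef_ge0.
have k0 : 0 < k by rewrite ltr_wpDr.
exists k => // w.
have wa a : qf G w (r a) = w 0 a.
  rewrite /qf /r -mulmxA -{1}pG.1 -trmx_mul -row_mul mulVmx// rowE mulmx1.
  by rewrite trmx_delta -colE mxE.
have b0 : 0 <= k * qf G w w by rewrite mulr_ge0 ?posdef_ge0// ltW.
rewrite -[leRHS]sqr_sqrtr// ler_sqr ?nnegrE ?sqrtr_ge0//.
apply: norm_mx_le; first exact: sqrtr_ge0.
move=> i a; rewrite (ord1 i) -sqrtr_sqr ler_sqrt// -wa.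
apply: le_trans (qf_cauchy _ _ pG) _; rewrite mulrC ler_wpM2r ?posdef_ge0//.
rewrite /k (bigD1 a)//= addrCA lerDl addr_ge0// sumr_ge0// => b _; exact: posdef_ge0.
Qed.

(** Entrywise closeness becomes relative closeness of the forms, because [posdef_lower] bounds |w|^2
    by a multiple of [qf G0 w w]. *)
Lemma posdef_perturb G0 : posdef G0 -> forall e : R, 0 < e ->
  exists2 d : R, 0 < d & forall G, `|G - G0| < d -> forall w,
    `|qf G w w - qf G0 w w| <= e * qf G0 w w.
Proof.
move=> pG e e0; have [k k0 Hk] := posdef_lower pG.
have K0 : 0 < n%:R ^+ 2 * k + 1 by rewrite ltr_wpDl// mulr_ge0 ?sqr_ge0// ltW.
exists (e / (n%:R ^+ 2 * k + 1)); first by rewrite divr_gt0.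
move=> G; rewrite ltr_pdivlMr// => Gd w; rewrite -qfB.
apply: le_trans (qf_bound _ _ _) _; rewrite -[_ * `|w| * _]mulrA -expr2.
apply: (@le_trans _ _ (n%:R ^+ 2 * `|G - G0| * (k * qf G0 w w))).
  by rewrite ler_wpM2l// mulr_ge0// sqr_ge0.
rewrite mulrA ler_wpM2r ?posdef_ge0//; apply: le_trans (ltW Gd).
by rewrite mulrDr mulr1 mulrAC [leLHS]mulrC lerDl.
Qed.

(** [gnorm] for a bare matrix, so that the metric can be frozen at one point while the vector
    varies. *)
Definition gn G v : R := Num.sqrt (qf G v v).

Lemma gn_ge0 G v : 0 <= gn G v.
Proof. exact: sqrtr_ge0. Qed.

Lemma gnZ G a v : gn G (a *: v) = `|a| * gn G v.
Proof. by rewrite /gn qfZl qfZr mulrA -expr2 sqrtrM ?sqr_ge0// sqrtr_sqr. Qed.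

Lemma gn_sqr G v : posdef G -> gn G v ^+ 2 = qf G v v.
Proof. by move=> pG; rewrite sqr_sqrtr// posdef_ge0. Qed.

Lemma qf_le_gn G v w : posdef G -> qf G v w <= gn G v * gn G w.
Proof.
move=> pG; rewrite -sqrtrM ?posdef_ge0//; apply: le_trans (ler_norm _) _.
by rewrite -sqrtr_sqr ler_sqrt ?mulr_ge0 ?posdef_ge0// qf_cauchy.
Qed.

Lemma gnN G v : gn G (- v) = gn G v.
Proof. by rewrite -scaleN1r gnZ normrN normr1 mul1r. Qed.

Lemma gnD G v w : posdef G -> gn G (v + w) <= gn G v + gn G w.
Proof.
move=> pG; rewrite -[leRHS]ger0_norm ?addr_ge0 ?gn_ge0// -sqrtr_sqr ler_sqrt ?sqr_ge0//.
rewrite qfDl !qfDr (qfC w v pG.1) sqrrD !gn_sqr//.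
have := qf_le_gn v w pG; rewrite mulr2n.
by move: (qf G v v) (qf G v w) (qf G w w) (gn G v * gn G w) => *; lra.
Qed.

Lemma gn_le_norm G v : gn G v <= Num.sqrt (n%:R ^+ 2 * `|G|) * `|v|.
Proof.
rewrite -[X in _ * X]ger0_norm// -sqrtr_sqr -sqrtrM ?mulr_ge0 ?sqr_ge0//.
rewrite ler_sqrt ?mulr_ge0 ?sqr_ge0//.
by apply: le_trans (ler_norm _) _; apply: le_trans (qf_bound _ _ _) _; rewrite expr2 mulrA.
Qed.

Lemma gn_eq0 G v : posdef G -> gn G v <= 0 -> v = 0.
Proof.
move=> pG; rewrite le_eqVlt ltNge gn_ge0 orbF => /eqP g0.
apply/eqP/negPn/negP => /pG.2; rewrite -gn_sqr// g0 expr0n ltxx //.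
Qed.

End QuadraticForms.

(** * Gronwall's lemma and strict differentiability *)

Section GronwallScalar.
Context {R : realType}.

(** The function [expR (- K * t) * f t] has a nonpositive derivative; K may have either sign. *)
Lemma gronwall (f : R -> R) (K u v : R) : u <= v ->
  (forall t, u <= t <= v -> exists2 f', is_derive t 1 f f' & f' <= K * f t) ->
  f v <= expR (K * (v - u)) * f u.
Proof.
move=> uv fK.
pose h t := expR (- K * t) * f t.
have dh (t : R) : u <= t <= v -> exists2 h', is_derive t 1 h h' & h' <= 0.
  move=> /fK[f' df ff'].
  have dK : is_derive t 1 (fun s : R => - K * s) (- K).
    by apply: is_derive_eq; rewrite -[LHS]/(_ * _) mulr1.
  exists (expR (- K * t) *: f' + f t *: (expR (- K * t) * - K)).
    apply: is_deriveM.
  rewrite -![_ *: _]/(_ * _) mulrCA -mulrDr pmulr_rle0 ?expR_gt0//.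
  by rewrite mulrN subr_le0 mulrC.
have [t|t|t] := @MVT_segment R h (fun t => 'D_1 h t) u v uv.
- rewrite in_itv/= => /andP[/ltW ut /ltW tv].
  by have [|h' [dd <-] _] := dh t; [rewrite ut|exact: DeriveDef].
- apply: derivable_within_continuous => {}t; rewrite in_itv/= => /dh[h' [] //].
- rewrite in_itv/= => /dh[h' [_ ->] h0] E.
  have : h v <= h u by rewrite -subr_le0 E mulr_le0_ge0// subr_ge0.
  rewrite /h => hh.
  have e0 := expR_gt0 (K * v).
  rewrite -(ler_pM2l e0) !mulrA -!expRD in hh.
  by move: hh; rewrite mulNr subrr expR0 mul1r mulrBr mulNr.
Qed.

End GronwallScalar.

Section StrictDifferentiability.
Context {R : realType} {n : nat}.

(** Uniformity in both end points is what matters: x and x + w will be two integral curves that move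
    simultaneously. It comes from the mean value theorem and the continuity of the partial
    derivatives at [z0]. *)
Lemma strict_diff (U : set 'rV[R]_n) (f : 'rV[R]_n -> R) z0 : open U ->
  smooth_on U f -> U z0 -> forall e : R, 0 < e ->
  exists2 d : R, 0 < d & forall x w, `|x - z0| < d -> `|x + w - z0| < d ->
    `|f (x + w) - f x - 'D_w f x| <= e * `|w|.
Proof.
move=> oU sf Uz e e0.
(* Each of the n partial derivatives is compared with its value at [z0] twice, which gives 2n
   errors; n + 1 avoids dividing by zero when n = 0. *)
pose e' := e / (2 * (n%:R + 1)).
have n0 : 0 < (n%:R + 1 : R) by rewrite ltr_wpDl.
have e'0 : 0 < e' by rewrite divr_gt0// mulr_gt0.
have : \forall y \near z0, U y /\ forall a, `|partial a f z0 - partial a f y| < e'.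
  near=> y; split; first by near: y; exact: open_nbhs_nbhs.
  near: y; apply: filter_forall => a.
  have := smooth_continuous (smooth_partial a sf) Uz.
  by move/cvgrPdist_lt => /(_ _ e'0).
move=> /nbhs_ballP[d d0 Hd]; exists d => // x w xd xwd.
have B y : `|y - z0| < d -> U y /\ forall a, `|partial a f z0 - partial a f y| < e'.
  by move=> yd; apply: Hd; rewrite -ball_normE/= distrC.
have inb (t : R) : 0 <= t <= 1 -> `|x + t *: w - z0| < d.
  move=> /andP[t0 t1].
  have -> : x + t *: w - z0 = (1 - t) *: (x - z0) + t *: (x + w - z0).
    apply/matrixP => i j; rewrite !mxE.
    by move: (x i j) (w i j) (z0 i j) => *; ring.
  apply: le_lt_trans (ler_normD _ _) _; rewrite !normrZ (ger0_norm t0) ger0_norm ?subr_ge0//.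
  have [->|tn0] := eqVneq t 0; first by rewrite subr0 mul1r mul0r addr0.
  have tp : 0 < t by rewrite lt_def tn0.
  have -> : d = (1 - t) * d + t * d by ring.
  by rewrite ler_ltD// ?ltr_pM2l// ler_wpM2l ?subr_ge0// ltW.
have [t t01 ->] := mean_value_line (fun t h => smooth_differentiable sf (B _ (inb t h)).1).
rewrite !derive_partial; last 2 first.
- exact: smooth_differentiable sf (B _ xd).1.
- exact: smooth_differentiable sf (B _ (inb _ t01)).1.
rewrite -sumrB; apply: le_trans (ler_norm_sum _ _ _) _.
apply: (@le_trans _ _ (\sum_(a < n) `|w| * (e' + e'))).
  apply: ler_sum => a _; rewrite -mulrBr normrM ler_pM ?mx_entry_le_norm//.
  have -> : partial a f (x + t *: w) - partial a f x =
    (partial a f z0 - partial a f x) - (partial a f z0 - partial a f (x + t *: w)).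
    by move: (partial a f z0) (partial a f x) (partial a f _) => *; ring.
  apply: le_trans (ler_normB _ _) _; apply: lerD; apply: ltW.
    exact: (B _ xd).2.
  exact: (B _ (inb _ t01)).2.
rewrite sumr_const card_ord -[leLHS]mulr_natl mulrCA mulrC ler_wpM2r//.
have E : e = (e' + e') * (n%:R + 1) by rewrite /e'; field; rewrite gt_eqF.
by rewrite [leRHS]E mulrC ler_wpM2l ?addr_ge0 ?(ltW e'0)// lerDl.
Unshelve. all: by end_near. Qed.

Lemma strict_diff_mx (U : set 'rV[R]_n) m p (F : 'rV[R]_n -> 'M[R]_(m, p)) z0 : open U ->
  smooth_mx U F -> U z0 -> forall e : R, 0 < e ->
  exists2 d : R, 0 < d & forall x w, `|x - z0| < d -> `|x + w - z0| < d ->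
    `|F (x + w) - F x - 'D_w F x| <= e * `|w|.
Proof.
move=> oU sF Uz e e0.
pose P (d : R) := forall i j x w, `|x - z0| < d -> `|x + w - z0| < d ->
    U x /\ `|F (x + w) i j - F x i j - 'D_w (fun y => F y i j) x| <= e * `|w|.
have H : \forall d \near (0:R)^'+, P d.
  apply: filter_forall => i; apply: filter_forall => j.
  have [d d0 Hd] := strict_diff oU (sF i j) Uz e0.
  have /nbhs_ballP[r r0 Hr] : \forall y \near z0, U y by exact: open_nbhs_nbhs.
  near=> s => x w xs xws; split.
    apply: Hr; rewrite -ball_normE/= distrC (lt_le_trans xs)//.
    by near: s; exact: nbhs_right_le.
  have sd : s <= d by near: s; exact: nbhs_right_le.
  by apply: Hd; apply: lt_le_trans sd.
near (0:R)^'+ => d; have Pd : P d by near: d.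
exists d => // x w xd xwd.
apply: norm_mx_le; first by rewrite mulr_ge0// ltW.
move=> i j; have [Ux] := Pd i j x w xd xwd.
by rewrite derive_mx ?mxE//;
  exact/diff_derivable/(smooth_mx_differentiable sF).
Unshelve. all: by end_near. Qed.

End StrictDifferentiability.

(** * Growth of coordinate differences along integral curves *)

Section ChartEstimate.
Context {R : realType}.

Lemma is_derive_mx_entry (V : normedModType R) m n (M : V -> 'M[R]_(m, n)) x v dM i j :
  is_derive x v M dM -> is_derive x v (fun y => M y i j) (dM i j).
Proof.
move=> [d <-]; have d' : derivable (fun y => M y i j) x v by move/derivable_mxP : d; exact.
by apply: DeriveDef => //; rewrite derive_mx// mxE.
Qed.

Context {n : nat}.

(** On the diagonal the first and third derivative terms cancel by symmetry of g. What is left is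
    half the derivative of g(w, w) along the flow when w moves by the linearised field. *)
Lemma lowered_diag (G : 'rV[R]_n -> 'M[R]_n) (X : 'rV[R]_n -> 'rV[R]_n) x w :
  (forall v, ('D_v G x)^T = 'D_v G x) ->
  lowered G X x w w 0 0 =
    qf (G x) ('D_w X x) w + 2^-1 * qf ('D_(X x) G x) w w.
Proof.
move=> sG; rewrite /lowered /qf.
move: ('D_w G x) (sG w) ('D_(X x) G x) ('D_w X x) => A As B Y.
have -> : w *m A *m (X x)^T = X x *m A *m w^T.
  by rewrite -[LHS]trmx11 !trmx_mul trmxK As mulmxA.
by rewrite addrAC subrr add0r mxE [X in _ + X]mxE.
Qed.

Lemma derive_symmetric_mx (U : set 'rV[R]_n) (G : 'rV[R]_n -> 'M[R]_n) x v : open U -> smooth_mx U G -> U x ->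
  (forall z, U z -> (G z)^T = G z) -> ('D_v G x)^T = 'D_v G x.
Proof.
move=> oU sG Ux GT.
have dG : derivable G x v by exact/diff_derivable/(smooth_mx_differentiable sG).
have [_ <-] := derivable_trmx dG.
apply: near_eq_derive; near=> z; apply: GT; near: z; exact: open_nbhs_nbhs.
Unshelve. all: by end_near. Qed.

Lemma posdef_near (U : set 'rV[R]_n) (G : 'rV[R]_n -> 'M[R]_n) z0 : open U ->
  smooth_mx U G -> U z0 -> posdef (G z0) -> forall e : R, 0 < e ->
  exists2 d : R, 0 < d & forall z, `|z - z0| < d ->
    [/\ U z, `|G z - G z0| < e & forall w, `|qf (G z) w w - qf (G z0) w w| <= e * qf (G z0) w w].
Proof.
move=> oU sG Uz pG e e0.
have [d1 d10 H1] := posdef_perturb pG e0.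
have cG : {for z0, continuous G} by apply: differentiable_continuous; exact: smooth_mx_differentiable sG Uz.
have : \forall z \near z0, U z /\ `|G z0 - G z| < Num.min e d1.
  near=> z; split; first by near: z; exact: open_nbhs_nbhs.
  near: z; move/cvgrPdist_lt : cG => /(_ (Num.min e d1)); apply.
  by rewrite lt_min e0.
move=> /nbhs_ballP[d d0 Hd]; exists d => // z zd.
have [|Uz' ] := Hd z; first by rewrite -ball_normE/= distrC.
by rewrite distrC lt_min => /andP[He Hd1]; split => //; exact: H1.
Unshelve. all: by end_near. Qed.

(** Gronwall for g(w, w) with w = y - x and g taken at the moving point x. By [lowered_diag] its
    derivative is twice the [lowered] term plus 2 g(rho, w), where rho is the linearisation error of
    X; [strict_diff_mx] makes g(rho, w) at most e g(w, w). *)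
Lemma growth_in_chart (U : set 'rV[R]_n) (G : 'rV[R]_n -> 'M[R]_n)
    (X : 'rV[R]_n -> 'rV[R]_n) z0 : open U -> smooth_mx U G -> smooth_mx U X ->
  U z0 -> (forall z, U z -> posdef (G z)) -> forall e : R, 0 < e ->
  exists2 r : R, 0 < r & forall (C : R) (x y : R -> 'rV[R]_n) (u v : R), u <= v ->
  (forall t, u <= t <= v -> [/\ `|x t - z0| < r, `|y t - z0| < r,
     is_derive t 1 x (X (x t)), is_derive t 1 y (X (y t)) &
     forall w, lowered G X (x t) w w 0 0 <= C * qf (G (x t)) w w]) ->
  gn (G (x v)) (y v - x v) <= expR ((C + e) * (v - u)) * gn (G (x u)) (y u - x u).
Proof.
move=> oU sG sX Uz pG e e0.
have [k k0 Hk] := posdef_lower (pG _ Uz).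
have [r1 r10 H1] := posdef_near oU sG Uz (pG _ Uz) (ltac:(by rewrite invr_gt0) : 0 < 2^-1 :> R).
pose Mx : R := `|G z0| + 1.
have Mx0 : 0 < Mx by rewrite ltr_wpDl.
(* With the bound Mx on the metric and |w|^2 <= 2k g(w, w), K turns the estimate of [qf_bound] for
   g(w, w) into a multiple of g(w, w) itself. The divisor is K + 1 because K vanishes for n = 0. *)
pose K : R := n%:R ^+ 2 * Mx * (2 * k).
have K0 : 0 <= K by rewrite !mulr_ge0// ltW.
have K1 : 0 < K + 1 by rewrite ltr_wpDl.
have [r2 r20 H2] := strict_diff_mx oU sX Uz (divr_gt0 e0 K1).
exists (Num.min r1 r2); first by rewrite lt_min r10.
move=> C x y u v uv H.
pose w t := y t - x t.
pose phi t := qf (G (x t)) (w t) (w t).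
have pGx t : u <= t <= v -> posdef (G (x t)).
  by move=> /H[]; rewrite lt_min => /andP[/H1[/pG]].
suff : phi v <= expR ((2 * (C + e)) * (v - u)) * phi u.
  move=> L; rewrite /gn -/(phi v) -/(phi u).
  have E : expR (2 * (C + e) * (v - u)) = expR ((C + e) * (v - u)) ^+ 2.
    by rewrite -expRM_natl mulrA.
  rewrite -[X in X * _]ger0_norm ?expR_ge0// -sqrtr_sqr -sqrtrM ?sqr_ge0// -E.
  by rewrite ler_sqrt// mulr_ge0 ?expR_ge0// posdef_ge0//; apply: pGx; rewrite lexx.
apply: gronwall => // t tuv.
have [] := H t tuv; rewrite !lt_min => /andP[xr1 xr2] /andP[yr1 yr2] dx dy lC.
have [Ux Gd Gq] := H1 _ xr1.
have dG : differentiable G (x t) := smooth_mx_differentiable sG Ux.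
have dw : is_derive t 1 w (X (y t) - X (x t)) by apply: is_deriveB.
have dGx : is_derive t 1 (G \o x) ('D_(X (x t)) G (x t)) := is_derive_along dG dx.
have [dw' ew] := dw; have [dGx' eGx] := dGx.
have d1 := derivable_mulmx dw' dGx'.
have [d1' e1] := d1.
have dwT := derivable_trmx dw'; have [dwT' ewT] := dwT.
have d2 := derivable_mulmx d1' dwT'.
have := is_derive_mx_entry 0 0 d2; rewrite e1 ewT ew eGx /= => d3.
eexists; first exact: d3.
set rho := X (y t) - X (x t) - 'D_(w t) X (x t).
have rhole : `|rho| <= e / (K + 1) * `|w t|.
  by have := H2 (x t) (w t) xr2; rewrite [x t + _]addrC subrK; apply.
have -> : ((((X (y t) - X (x t)) *m G (x t) + w t *m 'D_(X (x t)) G (x t)) *m (w t)^T +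
     w t *m G (x t) *m (X (y t) - X (x t))^T) 0 0) =
   2 * lowered G X (x t) (w t) (w t) 0 0 + 2 * qf (G (x t)) rho (w t).
  rewrite lowered_diag; last first.
    by move=> z; apply: (derive_symmetric_mx _ oU sG Ux) => // z' /pG[].
  have -> : X (y t) - X (x t) = 'D_(w t) X (x t) + rho by rewrite /rho [RHS]addrC subrK.
  rewrite mulmxDl mxE [X in X + _]mxE -!/(qf _ _ _) (qfC (w t) _ (pGx _ tuv).1).
  by rewrite !qfDl; field.
have w2 : `|w t| ^+ 2 <= 2 * k * phi t.
  apply: le_trans (Hk _) _; rewrite -mulrA mulrCA ler_pM2l//.
  have := Gq (w t); rewrite ler_norml => /andP[+ _].
  by rewrite /phi; move: (qf _ _ _) (qf _ _ _) => a b; lra.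
have p0 : 0 <= phi t by rewrite posdef_ge0//; exact: pGx.
have rG : qf (G (x t)) rho (w t) <= e * phi t.
  apply: le_trans (ler_norm _) _; apply: le_trans (qf_bound _ _ _) _.
  have Gle : `|G (x t)| <= Mx.
    rewrite -(subrK (G z0) (G (x t))) (le_trans (ler_normD _ _))// addrC lerD2l.
    by rewrite ltW// (lt_trans Gd)// invf_lt1// ltr1n.
  apply: (@le_trans _ _ (n%:R ^+ 2 * Mx * (e / (K + 1) * `|w t|) * `|w t|)).
    by rewrite ler_wpM2r// ler_pM ?mulr_ge0// ler_wpM2l.
  have -> : n%:R ^+ 2 * Mx * (e / (K + 1) * `|w t|) * `|w t| =
    e * ((n%:R ^+ 2 * Mx * `|w t| ^+ 2) / (K + 1)) by ring.
  rewrite ler_pM2l// ler_pdivrMr//.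
  apply: (@le_trans _ _ (n%:R ^+ 2 * Mx * (2 * k * phi t))).
    by rewrite ler_wpM2l// mulr_ge0// ltW.
  by rewrite mulrA -/K mulrDr mulr1 mulrC lerDl.
rewrite -mulrDr -mulrA ler_pM2l// mulrDl lerD//.
Qed.

End ChartEstimate.

(** * Tensoriality of the covariant differential *)

Section ChartChange.
Context {R : realType} {n : nat} (M : manifold R n) (g : metric M) (X : vector_field M).
Implicit Types (i j : cidx M) (p q : M) (z v w : 'rV[R]_n).

Local Notation ov i j := (overlap (atlas i) (atlas j)).

Lemma mmapK i p : mdom i p -> cinv (atlas i) (mmap i p) = p.
Proof. exact: cmapK. Qed.

Lemma mimg_open i : open (mimg i).
Proof. exact: cimg_open. Qed.

Lemma mimg_mmap i p : mdom i p -> mimg i (mmap i p).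
Proof. by move=> ip; exists p. Qed.

Lemma nbhs_mdom i p : mdom i p -> nbhs p (mdom i).
Proof. by move=> ip; apply: open_nbhs_nbhs; split => //; exact: cdom_open. Qed.

Lemma overlap_open i j : open (ov i j).
Proof.
rewrite openE => _ [p [ip jp] <-].
have zi : mimg i (mmap i p) by exact: mimg_mmap.
have cz := cinv_continuous zi.
have Nij : nbhs (cinv (atlas i) (mmap i p)) (mdom j).
  by rewrite mmapK//; exact: nbhs_mdom.
have N1 : nbhs (mmap i p) (cinv (atlas i) @^-1` mdom j) := cz _ Nij.
have N2 : nbhs (mmap i p) (mimg i).
  by apply: open_nbhs_nbhs; split => //; exact: mimg_open.
apply: filterS (filterI N1 N2) => y [/= + [q iq qy]].
by rewrite -qy mmapK// => jq; exists q.
Qed.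

Lemma overlap_mmap i j p : mdom i p -> mdom j p -> ov i j (mmap i p).
Proof. by move=> ip jp; exists p. Qed.

Lemma mtrans_mmap i j p : mdom i p -> mtrans i j (mmap i p) = mmap j p.
Proof. by move=> ip; rewrite /mtrans /transition/= mmapK. Qed.

Lemma mtrans_smooth i j : smooth_mx (ov i j) (mtrans i j).
Proof. by move=> a b; rewrite (ord1 a); exact: atlas_smooth. Qed.

Lemma mtrans_differentiable i j z : ov i j z -> differentiable (mtrans i j) z.
Proof. exact: smooth_mx_differentiable (mtrans_smooth i j). Qed.

Lemma gcoef_is_posdef i z : mimg i z -> posdef (gcoef g i z).
Proof. by move=> iz; split; [exact: gcoef_sym|move=> v v0; exact: gcoef_posdef]. Qed.

Lemma overlap_mimg i j z : ov i j z -> mimg i z /\ mimg j (mtrans i j z).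
Proof. by move=> [p [ip jp] <-]; split; [exists p|exists p => //; rewrite -(mtrans_mmap j ip)]. Qed.

Lemma gcoef_pjac i j z : ov i j z -> gcoef g i z =
  pjac (mtrans i j) z *m gcoef g j (mtrans i j z) *m (pjac (mtrans i j) z)^T.
Proof.
by move=> ijz; rewrite (gcoef_change g ijz) jacobian_pjac//; exact: mtrans_differentiable.
Qed.

Lemma xcoef_pjac i j z : ov i j z ->
  xcoef X j (mtrans i j z) = xcoef X i z *m pjac (mtrans i j) z.
Proof.
by move=> ijz; rewrite (xcoef_change X ijz) jacobian_pjac//; exact: mtrans_differentiable.
Qed.

(** The metric in chart i is invertible and factors through the Jacobian, so the inverse transition
    map need not be differentiated. *)
Lemma pjac_unitmx i j z : ov i j z -> pjac (mtrans i j) z \in unitmx.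
Proof.
move=> ijz; have := posdef_unitmx (gcoef_is_posdef (overlap_mimg ijz).1).
by rewrite (gcoef_pjac ijz) !unitmx_mul => /andP[/andP[]].
Qed.

Lemma qf_change i j z v w : ov i j z ->
  qf (gcoef g i z) v w =
  qf (gcoef g j (mtrans i j z)) (v *m pjac (mtrans i j) z) (w *m pjac (mtrans i j) z).
Proof. by move=> ijz; rewrite (gcoef_pjac ijz) /qf trmx_mul !mulmxA. Qed.

Lemma gn_change i j z v : ov i j z ->
  gn (gcoef g i z) v = gn (gcoef g j (mtrans i j z)) (v *m pjac (mtrans i j) z).
Proof. by move=> ijz; rewrite /gn -qf_change. Qed.

Lemma xcoef_smooth_mx i : smooth_mx (mimg i) (xcoef X i).
Proof. by move=> a b; rewrite (ord1 a); exact: xcoef_smooth. Qed.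

Lemma gcoef_smooth_mx i : smooth_mx (mimg i) (gcoef g i).
Proof. by move=> a b; exact: gcoef_smooth. Qed.

(** Koszul's formula: multiplication by the metric cancels the inverse metric in the Christoffel
    symbols. This links [nabla] to [lowered]. *)
Lemma nabla_lowered i z v w : mimg i z ->
  v *m nabla g X i z *m gcoef g i z *m w^T = lowered (gcoef g i) (xcoef X i) z v w.
Proof.
move=> iz.
have uG := posdef_unitmx (gcoef_is_posdef iz).
have GT := gcoef_sym g iz.
pose dg a b l := partial a (fun y => gcoef g i y b l) z.
pose Xz := xcoef X i z.
(* Twice the Christoffel symbols of the first kind, contracted with X. *)
pose S : 'M[R]_n := \matrix_(a, l) \sum_b Xz 0 b * (dg a b l + dg b a l - dg l a b).
have NE : nabla g X i z *m gcoef g i z = pjac (xcoef X i) z *m gcoef g i z + 2^-1 *: S.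
  have -> : nabla g X i z = pjac (xcoef X i) z + 2^-1 *: (S *m (invmx (gcoef g i z))^T).
    apply/matrixP => a k; rewrite !mxE; congr (_ + _).
    rewrite /christoffel mulr_sumr.
    under eq_bigr do rewrite -mulrA mulr_suml -/Xz.
    rewrite -[LHS]mulr_sumr -[RHS]mulr_sumr exchange_big /=; congr (_ * _).
    apply: eq_bigr => l _; rewrite !mxE mulr_suml; apply: eq_bigr => b _.
    by rewrite mulrC [invmx _ _ _ * _]mulrC mulrA.
  by rewrite mulmxDl -scalemxAl -mulmxA trmx_inv GT mulVmx// mulmx1.
rewrite -(mulmxA v) NE mulmxDr mulmxDl /lowered.
have dX : differentiable (xcoef X i) z := smooth_mx_differentiable (@xcoef_smooth_mx i) iz.
have dG : differentiable (gcoef g i) z := smooth_mx_differentiable (@gcoef_smooth_mx i) iz.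
rewrite (pjacE v dX) mulmxA; congr (_ + _).
rewrite -scalemxAr -scalemxAl; congr (_ *: _).
have DG u b l : ('D_u (gcoef g i) z) b l = \sum_a u 0 a * dg a b l.
  rewrite derive_mx; last exact: diff_derivable.
  have d := smooth_differentiable (gcoef_smooth g i b l) iz.
  by rewrite mxE (derive_partial _ d).
have ext (A B C D : 'M[R]_1) : A 0 0 = B 0 0 + C 0 0 - D 0 0 -> A = B + C - D.
  by move=> E; apply/matrixP => i1 i2; rewrite !ord1 !mxE.
apply: ext; rewrite -/Xz.
move: ('D_v (gcoef g i) z) (DG v) ('D_Xz (gcoef g i) z) (DG Xz) ('D_w (gcoef g i) z) (DG w).
move: Xz @S NE => Xz S _ Dv DvE DX DXE Dw DwE.
change (qf S v w = qf Dv Xz w + qf DX v w - qf Dw v Xz); rewrite !qfE.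
have -> : \sum_a \sum_l v 0 a * w 0 l * S a l =
  \sum_a \sum_l \sum_b v 0 a * w 0 l * Xz 0 b * (dg a b l + dg b a l - dg l a b).
  by apply: eq_bigr => a _; apply: eq_bigr => l _; rewrite mxE mulr_sumr; apply: eq_bigr => b _; rewrite mulrA.
have -> : \sum_b \sum_l Xz 0 b * w 0 l * Dv b l =
  \sum_a \sum_l \sum_b v 0 a * w 0 l * Xz 0 b * dg a b l.
  under eq_bigr do under eq_bigr do rewrite DvE mulr_sumr.
  under eq_bigr do rewrite exchange_big.
  rewrite exchange_big; apply: eq_bigr => a _ /=; rewrite exchange_big.
  by apply: eq_bigr => l _; apply: eq_bigr => b _; ring.
have -> : \sum_a \sum_l v 0 a * w 0 l * DX a l =
  \sum_a \sum_l \sum_b v 0 a * w 0 l * Xz 0 b * dg b a l.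
  apply: eq_bigr => a _; apply: eq_bigr => l _; rewrite DXE mulr_sumr.
  by apply: eq_bigr => b _; rewrite mulrA.
have -> : \sum_a \sum_b v 0 a * Xz 0 b * Dw a b =
  \sum_a \sum_l \sum_b v 0 a * w 0 l * Xz 0 b * dg l a b.
  apply: eq_bigr => a _; rewrite exchange_big; apply: eq_bigr => b _ /=.
  rewrite DwE mulr_sumr; apply: eq_bigr => l _; ring.
rewrite -!big_split -sumrB; apply: eq_bigr => a _ /=.
rewrite -!big_split -sumrB; apply: eq_bigr => l _ /=.
rewrite -!big_split -sumrB; apply: eq_bigr => b _ /=.
by rewrite -!mulrDr -mulrBr.
Qed.

(** Both sides give the same form g(nabla_v X, w) by [lowered_change]; testing on unit vectors and
    cancelling the invertible factor [G' *m P^T] yields the matrix identity. *)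
Lemma nabla_change i j z : ov i j z ->
  nabla g X i z *m pjac (mtrans i j) z =
  pjac (mtrans i j) z *m nabla g X j (mtrans i j z).
Proof.
move=> ijz; have [iz jz] := overlap_mimg ijz.
set P := pjac _ _; set G' := gcoef g j (mtrans i j z).
have uP : P \in unitmx by exact: pjac_unitmx.
have uG : G' \in unitmx by apply: posdef_unitmx; exact: gcoef_is_posdef.
have E v w : v *m (nabla g X i z *m P *m (G' *m P^T)) *m w^T =
             v *m (P *m nabla g X j (mtrans i j z) *m (G' *m P^T)) *m w^T.
  have := nabla_lowered v w iz.
  rewrite (@lowered_change _ _ (ov i j) (mtrans i j) _ (gcoef g j) _ (xcoef X j)) //.
  - rewrite -nabla_lowered// (gcoef_pjac ijz) -/P -/G' trmx_mul !mulmxA; exact.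
  - exact: overlap_open.
  - exact: mtrans_smooth.
  - exact: (smooth_mx_differentiable (@gcoef_smooth_mx i) iz).
  - exact: (smooth_mx_differentiable (@gcoef_smooth_mx j) jz).
  - exact: (smooth_mx_differentiable (@xcoef_smooth_mx i) iz).
  - exact: (smooth_mx_differentiable (@xcoef_smooth_mx j) jz).
  - by move=> u; exact: gcoef_pjac.
  - by move=> u; exact: xcoef_pjac.
  - exact: gcoef_sym.
have : nabla g X i z *m P *m (G' *m P^T) = P *m nabla g X j (mtrans i j z) *m (G' *m P^T).
  apply/matrixP => a b; have := E (delta_mx 0 a) (delta_mx 0 b).
  move=> /matrixP/(_ 0 0).
  by rewrite trmx_delta -!rowE -!colE !mxE.
have uGP : G' *m P^T \in unitmx by rewrite unitmx_mul uG unitmx_tr.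
by move=> /(congr1 (mulmx^~ (invmx (G' *m P^T)))); rewrite !mulmxK.
Qed.

End ChartChange.

(** * Local bounds and the operator norm of nabla X *)

Section DerivativeBound.
Context {R : realType} {n : nat}.

Lemma derive_bound_near m p (U : set 'rV[R]_n) (F : 'rV[R]_n -> 'M[R]_(m, p)) z0 : open U ->
  smooth_mx U F -> U z0 ->
  exists2 d : R, 0 < d & exists2 B : R, 0 < B & forall z, `|z - z0| < d ->
    [/\ U z, `|F z| <= B & forall y, `|'D_y F z| <= B * `|y|].
Proof.
move=> oU sF Uz.
pose S : R := \sum_a \sum_i \sum_j `|partial a (fun y => F y i j) z0|.
have S0 : 0 <= S by do 3![apply: sumr_ge0 => ? _].
have le1 a i j : `|partial a (fun y => F y i j) z0| <= S.
  rewrite /S (bigD1 a)//= (bigD1 i)//= (bigD1 j)//= -!addrA lerDl.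
  by rewrite !addr_ge0 ?sumr_ge0// => ? _; do ?[apply: sumr_ge0 => ? _].
have cF : {for z0, continuous F}.
  by apply: differentiable_continuous; exact: smooth_mx_differentiable sF Uz.
have : \forall z \near z0, [/\ U z, `|F z0 - F z| < 1 &
    forall a i j, `|partial a (fun y => F y i j) z0 - partial a (fun y => F y i j) z| < 1].
  near=> z; split.
  - by near: z; exact: open_nbhs_nbhs.
  - by near: z; move/cvgrPdist_lt : cF => /(_ 1); apply.
  - near: z; apply: filter_forall => a; apply: filter_forall => i; apply: filter_forall => j.
    have := smooth_continuous (smooth_partial a (sF i j)) Uz.
    by move/cvgrPdist_lt => /(_ 1); apply.
move=> /nbhs_ballP[d d0 Hd]; exists d => //.
exists (`|F z0| + n%:R * (S + 1) + 1).
  by rewrite ltr_wpDl// addr_ge0// mulr_ge0// addr_ge0.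
move=> z zd; have [|Uz' Fz Pz] := Hd z; first by rewrite -ball_normE/= distrC.
have nS : 0 <= n%:R * (S + 1) :> R by rewrite mulr_ge0// addr_ge0.
split => //.
  have -> : F z = F z0 - (F z0 - F z) by rewrite opprB addrC subrK.
  apply: le_trans (ler_normB _ _) _; rewrite -addrA lerD2l.
  by rewrite (le_trans (ltW Fz))// lerDr.
move=> y; rewrite derive_mx; last exact/diff_derivable/(smooth_mx_differentiable sF).
apply: norm_mx_le; first by rewrite mulr_ge0// !addr_ge0.
move=> i j; rewrite mxE (derive_partial _ (smooth_differentiable (sF i j) Uz')).
apply: le_trans (ler_norm_sum _ _ _) _.
apply: (@le_trans _ _ (\sum_(a < n) `|y| * (S + 1))).
  apply: ler_sum => a _; rewrite normrM ler_pM// ?mx_entry_le_norm//.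
  have -> : partial a (fun y => F y i j) z = partial a (fun y => F y i j) z0 -
     (partial a (fun y => F y i j) z0 - partial a (fun y => F y i j) z).
    by rewrite opprB addrC subrK.
  apply: le_trans (ler_normB _ _) _; apply: lerD; first exact: le1.
  exact/ltW/Pz.
rewrite sumr_const card_ord -[leLHS]mulr_natl mulrCA mulrC ler_wpM2r//.
by rewrite -addrA [leRHS]addrCA lerDl addr_ge0.
Unshelve. all: by end_near. Qed.

End DerivativeBound.

Section NablaNorm.
Context {R : realType} {n : nat} (M : manifold R n) (g : metric M) (X : vector_field M).
Implicit Types (i j : cidx M) (p q : M) (z v w : 'rV[R]_n).

Local Notation ov i j := (overlap (atlas i) (atlas j)).

(* K bounds the operator norm of nabla X in chart i; unlike [nabla_norm] this can be
   stated in any chart. *)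
Definition opbound i z (K : R) : Prop :=
  forall w, gn (gcoef g i z) (w *m nabla g X i z) <= K * gn (gcoef g i z) w.

Lemma opbound_change i j p K : mdom i p -> mdom j p ->
  opbound i (mmap i p) K -> opbound j (mmap j p) K.
Proof.
move=> ip jp bi w.
have ji : ov j i (mmap j p) by exact: overlap_mmap.
rewrite !(gn_change g _ ji) (mtrans_mmap i jp) -mulmxA (nabla_change g X ji) mulmxA.
by rewrite (mtrans_mmap i jp); exact: bi.
Qed.

Lemma lowered_entry (G : 'rV[R]_n -> 'M[R]_n) (Y : 'rV[R]_n -> 'rV[R]_n) z v w :
  lowered G Y z v w 0 0 = qf (G z) ('D_v Y z) w + 2^-1 * (qf ('D_v G z) (Y z) w
    + qf ('D_(Y z) G z) v w - qf ('D_w G z) v (Y z)).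
Proof.
rewrite /lowered /qf.
move: ('D_v Y z) ('D_v G z) ('D_(Y z) G z) ('D_w G z) => a A B C.
by rewrite mxE; congr (_ + _); rewrite mxE; congr (_ * _); rewrite mxE mxE [X in _ + X]mxE.
Qed.

(** For u = nabla_w X, g(u, u) is the [lowered] form at (w, u), which local bounds on g, X and their
    first derivatives majorise by a multiple of |w| |u|. Dividing by the length of u gives the
    operator bound. *)
Lemma opbound_near i z0 : mimg i z0 ->
  exists2 d : R, 0 < d & exists2 K : R, 0 < K & forall z, `|z - z0| < d ->
    mimg i z /\ opbound i z K.
Proof.
move=> iz.
have pG := gcoef_is_posdef g iz.
have [k k0 Hk] := posdef_lower pG.
have oU := @mimg_open _ _ M i.
have half0 : 0 < 2^-1 :> R by rewrite invr_gt0.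
have [d1 d10 H1] := posdef_near oU (gcoef_smooth_mx g i) iz pG half0.
have [d2 d20 [B B0 H2]] := derive_bound_near oU (gcoef_smooth_mx g i) iz.
have [d3 d30 [D D0 H3]] := derive_bound_near oU (xcoef_smooth_mx X i) iz.
pose N : R := n%:R ^+ 2.
have N0 : 0 <= N by rewrite sqr_ge0.
(* The four terms of [lowered] carry the weights 1, 1/2, 1/2, 1/2, whose sum 5/2 is rounded up to
   3. *)
pose K1 := 3 * (N * B * D).
have K10 : 0 <= K1 by rewrite !mulr_ge0// ltW.
exists (Num.min d1 (Num.min d2 d3)); first by rewrite !lt_min d10 d20.
exists (K1 * (2 * k) + 1); first by rewrite ltr_wpDl// !mulr_ge0// ltW.
move=> z; rewrite !lt_min => /andP[/H1[Uz _ Gq] /andP[/H2[_ Gb DGb] /H3[_ Xb DXb]]].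
split => // w; set u := w *m nabla g X i z.
have pGz := gcoef_is_posdef g Uz.
have nle v : `|v| <= Num.sqrt (2 * k) * gn (gcoef g i z) v.
  rewrite -[`|v|]ger0_norm// -sqrtr_sqr -sqrtrM ?mulr_ge0 ?(ltW k0)//.
  rewrite ler_sqrt ?mulr_ge0 ?posdef_ge0 ?(ltW k0)//.
  apply: le_trans (Hk _) _; rewrite -mulrA mulrCA ler_pM2l//.
  have := Gq v; rewrite ler_norml => /andP[+ _].
  by move: (qf _ _ _) (qf _ _ _) => a b; lra.
have E : gn (gcoef g i z) u ^+ 2 = lowered (gcoef g i) (xcoef X i) z w u 0 0.
  by rewrite gn_sqr// -nabla_lowered.
have qle (A : 'M[R]_n) v1 v2 a b c : `|A| <= a -> `|v1| <= b -> `|v2| <= c ->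
    `|qf A v1 v2| <= N * a * b * c.
  move=> Aa vb vc; apply: le_trans (qf_bound _ _ _) _.
  by rewrite -/N ler_pM// ?mulr_ge0// ler_pM// ?mulr_ge0// ler_wpM2l.
have Le : gn (gcoef g i z) u ^+ 2 <= K1 * `|w| * `|u|.
  rewrite E lowered_entry.
  have T4 (a b c e T : R) : `|a| <= T -> `|b| <= T -> `|c| <= T -> `|e| <= T ->
      a + 2^-1 * (b + c - e) <= 3 * T.
    by rewrite !ler_norml => /andP[? ?] /andP[? ?] /andP[? ?] /andP[? ?]; lra.
  have -> : K1 * `|w| * `|u| = 3 * (N * B * D * `|w| * `|u|) by rewrite /K1; ring.
  apply: T4.
  - have -> : N * B * D * `|w| * `|u| = N * B * (D * `|w|) * `|u| by ring.
    exact: qle.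
  - have -> : N * B * D * `|w| * `|u| = N * (B * `|w|) * D * `|u| by ring.
    exact: qle.
  - have -> : N * B * D * `|w| * `|u| = N * (B * D) * `|w| * `|u| by ring.
    by apply: qle => //; apply: le_trans (DGb _) _; rewrite ler_wpM2l// ltW.
  - have -> : N * B * D * `|w| * `|u| = N * (B * `|u|) * `|w| * D by ring.
    exact: qle.
have gu := gn_ge0 (gcoef g i z) u; have gw := gn_ge0 (gcoef g i z) w.
have [u0|u0] := eqVneq (gn (gcoef g i z) u) 0.
  by rewrite u0 mulr_ge0// addr_ge0// mulr_ge0// mulr_ge0// ltW.
have up : 0 < gn (gcoef g i z) u by rewrite lt_def u0.
rewrite -(ler_pM2r up) -expr2; apply: le_trans Le _.
apply: (@le_trans _ _ (K1 * (Num.sqrt (2 * k) * gn (gcoef g i z) w) * (Num.sqrt (2 * k) * gn (gcoef g i z) u))).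
  apply: ler_pM => //; first exact: mulr_ge0.
  by rewrite ler_wpM2l.
have -> : K1 * (Num.sqrt (2 * k) * gn (gcoef g i z) w) * (Num.sqrt (2 * k) * gn (gcoef g i z) u) =
  K1 * (Num.sqrt (2 * k) ^+ 2) * gn (gcoef g i z) w * gn (gcoef g i z) u by ring.
rewrite sqr_sqrtr ?mulr_ge0 ?(ltW k0)//.
by rewrite ler_wpM2r// ler_wpM2r// lerDl.
Qed.

(** Makes the [sup] in [nabla_norm] a genuine least upper bound. *)
Lemma nabla_norm_has_sup p : has_sup [set Defs.gnorm g (chart_at p) (mmap (chart_at p) p)
    (Y *m nabla g X (chart_at p) (mmap (chart_at p) p)) |
    Y in [set Y : 'rV[R]_n | Defs.gnorm g (chart_at p) (mmap (chart_at p) p) Y <= 1]].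
Proof.
have iz : mimg (chart_at p) (mmap (chart_at p) p) by exact: mimg_mmap (chart_atP p).
split.
  exists 0; exists 0; last by rewrite /Defs.gnorm mul0mx !mul0mx mxE sqrtr0.
  by rewrite /= /Defs.gnorm !mul0mx mxE sqrtr0.
have [d d0 [K K0 H]] := opbound_near iz.
have [|_ bK] := H (mmap (chart_at p) p); first by rewrite subrr normr0.
exists K => _ [Y /= Y1 <-]; apply: le_trans (bK Y) _.
by rewrite ler_piMr// ltW.
Qed.

Lemma nabla_norm_opbound p : opbound (chart_at p) (mmap (chart_at p) p) (nabla_norm g X p).
Proof.
move=> w; set z := mmap _ _; set G := gcoef g _ z.
have iz : mimg (chart_at p) z by exact: mimg_mmap (chart_atP p).
have pG := gcoef_is_posdef g iz.
have [->|w0] := eqVneq w 0.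
  by rewrite mul0mx /gn /qf !mul0mx mxE sqrtr0 mulr0.
have gw : 0 < gn G w by rewrite /gn sqrtr_gt0; exact: pG.2.
rewrite -ler_pdivrMr// mulrC -[(gn G w)^-1]gtr0_norm ?invr_gt0// -gnZ scalemxAl.
apply: sup_upper_bound; first exact: nabla_norm_has_sup.
exists ((gn G w)^-1 *: w) => //=.
change (gn G ((gn G w)^-1 *: w) <= 1).
by rewrite gnZ gtr0_norm ?invr_gt0// mulVf// gt_eqF.
Qed.

Lemma nabla_norm_le p K : 0 <= K -> opbound (chart_at p) (mmap (chart_at p) p) K ->
  nabla_norm g X p <= K.
Proof.
move=> K0 bK; apply: sup_le_ub; first exact: (nabla_norm_has_sup p).1.
move=> _ [Y /= Y1 <-]; apply: le_trans (bK Y) _.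
by rewrite ler_piMr.
Qed.

(** The chart used by [nabla_norm] may change with p; the bound is found in the fixed chart i and
    carried over by [opbound_change]. *)
Lemma nabla_norm_near i p0 : mdom i p0 ->
  exists2 d : R, 0 < d & exists K : R, forall p, mdom i p ->
    `|mmap i p - mmap i p0| < d -> nabla_norm g X p <= K.
Proof.
move=> ip; have [d d0 [K K0 H]] := opbound_near (mimg_mmap ip).
exists d => //; exists K => p jp pd; apply: nabla_norm_le; first exact: ltW.
have [_ bK] := H _ pd.
by apply: opbound_change bK => //; exact: chart_atP.
Qed.

Lemma lowered_le_nabla_norm i p w C : mdom i p -> nabla_norm g X p <= C ->
  lowered (gcoef g i) (xcoef X i) (mmap i p) w w 0 0 <=
    C * qf (gcoef g i (mmap i p)) w w.
Proof.
move=> ip pC; have iz := mimg_mmap ip; have pG := gcoef_is_posdef g iz.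
rewrite -nabla_lowered//.
apply: le_trans (qf_le_gn (w *m nabla g X i (mmap i p)) w pG) _.
rewrite -gn_sqr// expr2 mulrA ler_wpM2r ?gn_ge0//.
have := opbound_change (chart_atP p) ip (@nabla_norm_opbound p) w => /le_trans; apply.
by rewrite ler_wpM2r ?gn_ge0.
Qed.

End NablaNorm.

(** * Induction on real intervals *)

Section RealInduction.
Context {R : realType}.

(** Let c be the supremum of the points reached from a. The local hypothesis at c joins a reached
    point just left of c to a point beyond c, unless c = b. *)
Lemma cousin (P : R -> R -> Prop) (a b : R) : a <= b ->
  (forall u v w, a <= u -> u <= v -> v <= w -> w <= b -> P u v -> P v w -> P u w) ->
  (forall s, a <= s <= b -> exists2 d : R, 0 < d &
     forall u v, a <= u -> v <= b -> s - d < u -> u <= s -> s <= v -> v < s + d -> P u v) ->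
  P a b.
Proof.
move=> ab Ptr Ploc.
pose A := [set s | a <= s <= b /\ P a s].
have Aa : A a.
  split; first by rewrite lexx.
  have [|d d0 H] := Ploc a; first by rewrite lexx.
  by apply: H => //; rewrite ?ltrBlDr ltrDl.
have supA : has_sup A by split; [exists a|exists b => s [/andP[]]].
pose c := sup A.
have ac : a <= c by apply: sup_upper_bound.
have cb : c <= b by apply: sup_le_ub; [exists a|move=> s [/andP[]]].
have [|d d0 H] := Ploc c; first by rewrite ac.
have [s [sab Pas] cds] := sup_adherent d0 supA.
have sc : s <= c by apply: sup_upper_bound.
have [as_ sb] := andP sab.
pose v := Num.min b (c + d / 2).
have d20 : 0 < d / 2 by rewrite divr_gt0.
have cv : c <= v by rewrite le_min cb lerDl ltW.
have vb : v <= b by rewrite ge_min lexx.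
have vd : v < c + d.
  by rewrite gt_min; apply/orP; right; rewrite ltrD2l ltr_pdivrMr// mulr_natr mulr2n ltrDl.
have Pav : P a v.
  by apply: (Ptr a s v) => //; [exact: le_trans cv|exact: H].
have : v <= c by apply: sup_upper_bound => //; split => //; rewrite (le_trans ac).
rewrite ge_min => /orP[bc|]; last by rewrite leNgt ltrDl d20.
suff <- : v = b by [].
by apply/eqP; rewrite eq_le vb (le_trans bc).
Qed.

(** The infimum of the counterexamples satisfies A by the first hypothesis, and so do its neighbours
    by the second. At t = u the first hypothesis is vacuous in its premise and acts as the base
    case. *)
Lemma open_induction (A : R -> Prop) (u v : R) :
  (forall t, u <= t <= v -> (forall s, u <= s < t -> A s) -> A t) ->
  (forall t, u <= t <= v -> A t -> \forall s \near t, A s) ->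
  forall t, u <= t <= v -> A t.
Proof.
move=> Aind Aop t0 t0uv; apply: contrapT => nA.
pose B := [set t | u <= t <= v /\ ~ A t].
have Bt : B t0 by [].
have infB : has_inf B by split; [exists t0|exists u => s [/andP[]]].
have infle s : B s -> inf B <= s by move=> Bs; apply: (ge_inf infB.2).
pose c := inf B.
have uc : u <= c by apply: lb_le_inf; [exists t0|move=> s [/andP[]]].
have cv : c <= v.
  by apply: (@le_trans _ _ t0); [exact: infle|case/andP: t0uv].
have Ac : A c.
  apply: Aind; first by rewrite uc.
  move=> s /andP[us sc]; apply: contrapT => nAs.
  have : c <= s by apply: infle; split => //; rewrite us (le_trans (ltW sc)).
  by rewrite leNgt sc.
have /nbhs_ballP[d d0 Hd] : \forall s \near c, A s by apply: Aop => //; rewrite uc.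
have [s [suv nAs] scd] := inf_adherent d0 infB.
apply: (nAs); apply: Hd; rewrite -ball_normE/= distrC ger0_norm.
  by rewrite ltrBlDl.
by rewrite subr_ge0; apply: infle; split.
Qed.

End RealInduction.

(** * Neighbourhoods and first-order distances in charts *)

Section ChartNeighbourhoods.
Context {R : realType} {n : nat} (M : manifold R n) (g : metric M).
Implicit Types (i j : cidx M) (p q : M).

Lemma chart_nbhs i p (V : set M) : mdom i p -> nbhs p V ->
  exists2 r : R, 0 < r & forall q, mdom i q -> `|mmap i q - mmap i p| < r -> V q.
Proof.
move=> ip Vp.
have cz := cinv_continuous (mimg_mmap ip).
have : nbhs (mmap i p) (cinv (atlas i) @^-1` V) by apply: cz; rewrite mmapK.
move=> /nbhs_ballP[r r0 Hr]; exists r => // q iq qr.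
by rewrite -(mmapK iq); apply: Hr; rewrite -ball_normE/= distrC.
Qed.

Lemma near_chart i p (r : R) : mdom i p -> 0 < r ->
  \forall q \near p, mdom i q /\ `|mmap i q - mmap i p| < r.
Proof.
move=> ip r0; near=> q; split; first by near: q; exact: nbhs_mdom.
rewrite distrC; near: q.
by have /cvgrPdist_lt := cmap_continuous ip; exact.
Unshelve. all: by end_near. Qed.

(* First-order substitute for the distance from p to q: the coordinate difference
   measured by the metric at p. A change of chart alters it by a factor that tends
   to 1 as q tends to p. *)
Definition cnorm i p q : R := gn (gcoef g i (mmap i p)) (mmap i q - mmap i p).

Lemma cnorm_ge0 i p q : 0 <= cnorm i p q.
Proof. exact: gn_ge0. Qed.

Lemma cnorm_eq0 i p q : mdom i p -> mdom i q -> cnorm i p q <= 0 -> q = p.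
Proof.
move=> ip iq /(gn_eq0 (gcoef_is_posdef g (mimg_mmap ip))) /eqP.
by rewrite subr_eq0 => /eqP E; rewrite -(mmapK iq) E mmapK.
Qed.

Lemma cnorm_near i p (r : R) : mdom i p -> 0 < r -> \forall q \near p, cnorm i p q < r.
Proof.
move=> ip r0; pose L := Num.sqrt (n%:R ^+ 2 * `|gcoef g i (mmap i p)|) + 1.
have L0 : 0 < L by rewrite ltr_wpDl// sqrtr_ge0.
have := near_chart ip (divr_gt0 r0 L0); apply: filterS => q [_].
rewrite ltr_pdivlMr// => qr; apply: le_lt_trans (gn_le_norm _ _) _.
by apply: le_lt_trans qr; rewrite mulrC ler_wpM2l// lerDl.
Qed.

(** The derivative of the transition map at p is an isometry between the two coordinate metrics, so
    only its first-order remainder contributes to the factor. *)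
Lemma cnorm_change i j p (e : R) : mdom i p -> mdom j p -> 0 < e ->
  \forall q \near p, cnorm j p q <= expR e * cnorm i p q.
Proof.
move=> ip jp e0.
have ijp := overlap_mmap ip jp.
have pGi := gcoef_is_posdef g (mimg_mmap ip).
have pGj := gcoef_is_posdef g (mimg_mmap jp).
have [k k0 Hk] := posdef_lower pGi.
have dphi := mtrans_differentiable ijp.
(* The remainder is measured by the metric in chart j, and |w| by the metric in chart i; L absorbs
   both comparison constants. *)
pose L := Num.sqrt (n%:R ^+ 2 * `|gcoef g j (mmap j p)|) * Num.sqrt k + 1.
have L0 : 0 < L by rewrite ltr_wpDl// mulr_ge0// sqrtr_ge0.
have [d d0 Hd] := diff_littleo dphi (divr_gt0 e0 L0).
have N1 := near_chart ip d0; have N2 := nbhs_mdom jp.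
apply: filterS (filterI N1 N2) => q [[iq qd] jq].
have := Hd _ qd.
set w := mmap i q - mmap i p.
rewrite -deriveE// pjacE//.
have -> : mmap i p + w = mmap i q by rewrite /w addrC subrK.
rewrite !mtrans_mmap//; set rho := _ - _ *m _ => rhole.
rewrite /cnorm.
have -> : mmap j q - mmap j p = w *m pjac (mtrans i j) (mmap i p) + rho.
  by rewrite /rho [RHS]addrC subrK.
apply: le_trans (gnD _ _ pGj) _.
have <- : gn (gcoef g i (mmap i p)) w = gn (gcoef g j (mmap j p)) (w *m pjac (mtrans i j) (mmap i p)).
  by rewrite (gn_change g w ijp) mtrans_mmap.
rewrite -/w.
apply: (@le_trans _ _ ((1 + e) * gn (gcoef g i (mmap i p)) w)); last first.
  by rewrite ler_wpM2r ?gn_ge0// expR_ge1Dx.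
rewrite mulrDl mul1r lerD2l.
apply: le_trans (gn_le_norm _ _) _.
have wk : `|w| <= Num.sqrt k * gn (gcoef g i (mmap i p)) w.
  rewrite -[`|w|]ger0_norm// -sqrtr_sqr -sqrtrM ?(ltW k0)//.
  by rewrite ler_sqrt ?mulr_ge0 ?posdef_ge0 ?(ltW k0).
set s := Num.sqrt (n%:R ^+ 2 * _).
have s0 : 0 <= s by exact: sqrtr_ge0.
have eL : 0 <= e / L by rewrite ltW// divr_gt0.
apply: (@le_trans _ _ (s * (e / L * (Num.sqrt k * gn (gcoef g i (mmap i p)) w)))).
  by rewrite ler_wpM2l//; apply: le_trans rhole _; rewrite ler_wpM2l.
rewrite !mulrA ler_wpM2r ?gn_ge0//.
have -> : s * e / L * Num.sqrt k = e * ((s * Num.sqrt k) / L) by ring.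
by rewrite ler_piMr ?(ltW e0)// ler_pdivrMr// mul1r lerDl.
Qed.

End ChartNeighbourhoods.

(** * Comparison of nearby integral curves *)

Lemma norm_sub_continuous {R : realType} (V : normedModType R) (z0 : V) :
  continuous (fun z : V => `|z - z0|).
Proof.
move=> z; apply/cvgrPdist_lt => e e0; apply/nbhs_ballP; exists e => // y.
rewrite -ball_normE /= => zy; apply: le_lt_trans (ler_dist_dist _ _) _.
by rewrite opprB addrA subrK.
Qed.

Section FlowGrowth.
Context {R : realType} {n : nat} (M : manifold R n) (g : metric M) (X : vector_field M).
Implicit Types (i j : cidx M) (p q : M) (x y : R -> M) (u v t : R).

(** Derivatives are two-sided even at u and v, as they are on a closed interval inside the open
    domain of an integral curve. *)
Definition runs x u v := forall t, u <= t <= v ->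
  {for t, continuous x} /\ forall i, mdom i (x t) ->
    is_derive t 1 (mmap i \o x) (xcoef X i (mmap i (x t))).

Lemma runs_sub x u v u' v' : u <= u' -> v' <= v -> runs x u v -> runs x u' v'.
Proof.
move=> uu vv xr t /andP[ut tv]; apply: xr.
by rewrite (le_trans uu)// (le_trans tv).
Qed.

(* This is where the Hausdorff property is used: it keeps an integral curve whose
   coordinates stay in a closed ball from leaving the chart. *)
Lemma chart_ball_closed i (z0 : 'rV[R]_n) (r : R) :
  (forall z, `|z - z0| <= r -> mimg i z) ->
  closed [set q : M | mdom i q /\ `|mmap i q - z0| <= r].
Proof.
move=> Hr.
have -> : [set q : M | mdom i q /\ `|mmap i q - z0| <= r] =
    cinv (atlas i) @` [set z | `|z - z0| <= r].
  apply/seteqP; split=> [q [iq qr]|_ [z zr <-]] /=.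
    by exists (mmap i q) => //; exact: mmapK.
  have [q iq E] := Hr _ zr.
  by rewrite -E mmapK// E.
apply: compact_closed; first exact: mhausdorff.
apply: continuous_compact.
  apply: continuous_in_subspaceT => z; rewrite inE => zr.
  exact: (cinv_continuous (Hr _ zr)).
apply: bounded_closed_compact.
  exists (`|z0| + r); split; first exact: num_real.
  move=> K HK z /= zr; rewrite ltW// (le_lt_trans _ HK)//.
  by rewrite -(subrK z0 z) addrC (le_trans (ler_normD _ _))// lerD2l.
have -> : [set z : 'rV[R]_n | `|z - z0| <= r] = (fun z => `|z - z0|) @^-1` [set a | a <= r] by [].
apply: closed_comp; last exact: closed_le.
by move=> z _; exact: norm_sub_continuous.
Qed.

(** The radius and B depend only on [p0] and e, whereas the neighbourhood of [x u] may depend on x,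
    u, v and rho. The curve y is only assumed to run on [u, v]; that it stays in the chart is part
    of what is shown. *)
Lemma local_growth i p0 (e : R) : mdom i p0 -> 0 < e ->
  exists2 r : R, 0 < r & exists B : R, forall (C : R) x u v, u <= v ->
  runs x u v ->
  (forall t, u <= t <= v -> [/\ mdom i (x t), `|mmap i (x t) - mmap i p0| < r &
     nabla_norm g X (x t) <= C]) ->
  forall rho : R, 0 < rho -> \forall q \near x u, forall y, runs y u v -> y u = q ->
    [/\ forall t, u <= t <= v -> nabla_norm g X (y t) <= B,
        mdom i (y v), `|mmap i (y v) - mmap i (x v)| < rho &
        cnorm g i (x v) (y v) <= expR ((C + e) * (v - u)) * cnorm g i (x u) (y u)].
Proof.
move=> ip e0; set z0 := mmap i p0.
have iz : mimg i z0 by exact: mimg_mmap.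
have oU := @mimg_open _ _ M i.
have pG z : mimg i z -> posdef (gcoef g i z) := @gcoef_is_posdef _ _ M g i z.
have [r0 r00 H0] := growth_in_chart oU (gcoef_smooth_mx g i) (xcoef_smooth_mx X i) iz pG e0.
have [k k0 Hk] := posdef_lower (pG _ iz).
have half0 : 0 < 2^-1 :> R by rewrite invr_gt0.
have [r1 r10 H1] := posdef_near oU (gcoef_smooth_mx g i) iz (pG _ iz) half0.
have [r2 r20 [B HB]] := nabla_norm_near g X ip.
(* The three radii serve the growth estimate, the comparison of the metric with its value at [z0]
   (inside the chart), and the bound B. *)
pose rm := Num.min r0 (Num.min r1 r2).
have rm0 : 0 < rm by rewrite !lt_min r00 r10.
pose r := rm / 2.
have rp : 0 < r by rewrite divr_gt0.
have rrm : r < rm by rewrite ltr_pdivrMr// mulr_natr mulr2n ltrDl.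
have rr0 : r < r0 by rewrite (lt_le_trans rrm)// ge_min lexx.
have rr1 : r < r1 by rewrite (lt_le_trans rrm)// !ge_min lexx orbT.
have rr2 : r < r2 by rewrite (lt_le_trans rrm)// !ge_min lexx !orbT.
exists (r / 2); first by rewrite divr_gt0.
have r2r : r / 2 < r by rewrite ltr_pdivrMr// mulr_natr mulr2n ltrDl.
exists B => C x u v uv xr Hx rho rho0.
(* The absolute value dominates the growth factor at all intermediate times, since C + e may be
   negative. *)
pose E := expR (`|C + e| * (v - u)).
have sk : 0 <= Num.sqrt (2 * k) by exact: sqrtr_ge0.
pose m := Num.min (r / 2) rho.
have m0 : 0 < m by rewrite lt_min rho0 divr_gt0.
pose L := Num.sqrt (2 * k) * E + 1.
have L0 : 0 < L by rewrite ltr_wpDl// mulr_ge0// expR_ge0.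
have uuv : u <= u <= v by rewrite lexx.
have [ixu xur _] := Hx _ uuv.
have N1 := cnorm_near g ixu (divr_gt0 m0 L0).
have N2 := nbhs_mdom ixu.
have rx0 : 0 < r - `|mmap i (x u) - z0| by rewrite subr_gt0 (lt_trans xur).
have N3 := near_chart ixu rx0.
apply: filterS (filterI N1 (filterI N2 N3)) => q [Nq [iq [_ qr]]] y yr yq.
pose A t := mdom i (y t) /\ `|mmap i (y t) - z0| < r.
have Au : A u.
  split; rewrite yq//.
  have -> : mmap i q - z0 = (mmap i q - mmap i (x u)) + (mmap i (x u) - z0).
    by rewrite addrA subrK.
  by rewrite (le_lt_trans (ler_normD _ _))// -ltrBrDr.
(* Only the closed ball is demanded of y, so that the estimate is still available at a first exit
   time. *)
have est t : u <= t <= v -> (forall s, u <= s <= t -> mdom i (y s) /\ `|mmap i (y s) - z0| <= r) ->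
    cnorm g i (x t) (y t) <= expR ((C + e) * (t - u)) * cnorm g i (x u) (y u) /\
    `|mmap i (y t) - mmap i (x t)| < m.
  move=> /andP[ut tv] yA.
  have [ixt xtr _] : [/\ mdom i (x t), `|mmap i (x t) - z0| < r / 2 & nabla_norm g X (x t) <= C].
    by apply: Hx; rewrite ut.
  have est1 : cnorm g i (x t) (y t) <= expR ((C + e) * (t - u)) * cnorm g i (x u) (y u).
    apply: (H0 C (mmap i \o x) (mmap i \o y)) => // s /andP[us st].
    have suv : u <= s <= v by rewrite us (le_trans st).
    have [ixs xsr xC] := Hx _ suv.
    have [|iys ysr] := yA s; first by rewrite us.
    split.
    - by rewrite /= (lt_trans xsr)// (lt_trans r2r).
    - by rewrite /= (le_lt_trans ysr).
    - exact: (xr _ suv).2.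
    - exact: (yr _ suv).2.
    - by move=> w; exact: lowered_le_nabla_norm.
  split => //.
  have [_ _ Gq] := H1 _ (lt_trans xtr (lt_trans r2r rr1)).
  have w2 : `|mmap i (y t) - mmap i (x t)| <= Num.sqrt (2 * k) * cnorm g i (x t) (y t).
    rewrite -[leLHS]ger0_norm// -sqrtr_sqr -sqrtrM ?mulr_ge0 ?(ltW k0)//.
    have pGx := pG _ (mimg_mmap ixt).
    rewrite ler_sqrt ?mulr_ge0 ?posdef_ge0 ?(ltW k0)//.
    apply: le_trans (Hk _) _; rewrite -mulrA mulrCA ler_pM2l//.
    have := Gq (mmap i (y t) - mmap i (x t)); rewrite ler_norml => /andP[+ _].
    by move: (qf _ _ _) (qf _ _ _) => a b; lra.
  apply: le_lt_trans w2 _.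
  apply: (@le_lt_trans _ _ (L * cnorm g i (x u) (y u))); last first.
    by rewrite yq mulrC -ltr_pdivlMr.
  apply: (@le_trans _ _ (Num.sqrt (2 * k) * E * cnorm g i (x u) (y u))); last first.
    by rewrite ler_wpM2r ?cnorm_ge0// lerDl.
  rewrite -mulrA ler_wpM2l//; apply: le_trans est1 _.
  rewrite ler_wpM2r ?cnorm_ge0// ler_expR.
  apply: (@le_trans _ _ (`|C + e| * (t - u))).
    by rewrite ler_wpM2r ?subr_ge0// ler_norm.
  by rewrite ler_wpM2l// lerD2r.
(* Bootstrap. Openness is continuity of y. In the limit step y t is a left limit of points in a set
   closed in M, hence still in the chart; [est] then puts it within r / 2 of x t, which is itself
   within r / 2 of [z0]. *)
have Aall : forall t, u <= t <= v -> A t.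
  apply: open_induction => [t tuv At|t tuv [iyt ytr]]; last first.
    have cy := (yr _ tuv).1.
    have rt0 : 0 < r - `|mmap i (y t) - z0| by rewrite subr_gt0.
    have := cy _ (near_chart iyt rt0); rewrite /= nbhs_simpl => N.
    near=> s; have [iys ysr] : mdom i (y s) /\ `|mmap i (y s) - mmap i (y t)| < r - `|mmap i (y t) - z0|.
      by near: s; exact: N.
    split => //.
    have -> : mmap i (y s) - z0 = (mmap i (y s) - mmap i (y t)) + (mmap i (y t) - z0).
      by rewrite addrA subrK.
    by rewrite (le_lt_trans (ler_normD _ _))// -ltrBrDr.
  have [->//|tu] := eqVneq t u.
  have [ut tv] := andP tuv.
  have ut' : u < t by rewrite lt_neqAle eq_sym tu.
  have cl : closed [set q : M | mdom i q /\ `|mmap i q - z0| <= r].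
    apply: chart_ball_closed => z zr.
    by have [] := H1 z (le_lt_trans zr rr1).
  have yt : mdom i (y t) /\ `|mmap i (y t) - z0| <= r.
    have H : \forall s \near t^'-, [set q : M | mdom i q /\ `|mmap i q - z0| <= r] (y s).
      near=> s; have [|? ?] := At s; last by split => //; exact: ltW.
      apply/andP; split; last by near: s; exact: nbhs_left_lt.
      by near: s; exact: nbhs_left_ge.
    exact: (closed_cvg _ cl H _ (cvg_at_left_filter (yr _ tuv).1)).
  have [|_ mt] := est t tuv.
    move=> s /andP[us]; rewrite le_eqVlt => /orP[/eqP->//|st].
    by have [|? ?] := At s; [rewrite us|split => //; exact: ltW].
  split; first exact: yt.1.
  have [_ xtr _] := Hx _ tuv.
  have -> : mmap i (y t) - z0 = (mmap i (y t) - mmap i (x t)) + (mmap i (x t) - z0).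
    by rewrite addrA subrK.
  apply: le_lt_trans (ler_normD _ _) _; rewrite [r]splitr ltrD//.
  by rewrite (lt_le_trans mt)// ge_min lexx.
have vuv : u <= v <= v by rewrite uv lexx.
have [|ev mv] := est v vuv.
  by move=> s /Aall[? ?]; split => //; exact: ltW.
split => //.
- by move=> t /Aall[iyt ytr]; apply: HB => //; exact: lt_trans rr2.
- exact: (Aall _ vuv).1.
- by rewrite (lt_le_trans mv)// ge_min lexx orbT.
Unshelve. all: by end_near. Qed.

Lemma path_chart x s i (r : R) : {for s, continuous x} -> mdom i (x s) -> 0 < r ->
  exists2 d : R, 0 < d & forall t, s - d < t -> t < s + d ->
    mdom i (x t) /\ `|mmap i (x t) - mmap i (x s)| < r.
Proof.
move=> cx ix r0; have := cx _ (near_chart ix r0); rewrite /= nbhs_simpl.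
move=> /nbhs_ballP[d d0 Hd]; exists d => // t t1 t2; apply: Hd.
by rewrite -ball_normE/= ltr_norml; apply/andP; split; lra.
Qed.

(** [nabla_norm] has been shown locally bounded, not continuous, so compactness of [u, v] enters
    through [cousin]. *)
Lemma nabla_norm_path_bounded x u v : u <= v ->
  (forall t, u <= t <= v -> {for t, continuous x}) ->
  exists C, forall t, u <= t <= v -> nabla_norm g X (x t) <= C.
Proof.
move=> uv cx.
apply: (@cousin R (fun u v => exists C, forall t, u <= t <= v -> nabla_norm g X (x t) <= C)) => //.
  move=> a b c _ ab bc _ [C1 H1] [C2 H2]; exists (Num.max C1 C2) => t /andP[at_ tc].
  rewrite le_max; have [tb|bt] := leP t b.
    by rewrite H1// at_ tb.
  by rewrite H2 ?orbT// (ltW bt).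
move=> s suv; have iz := chart_atP (x s).
have [r r0 [K HK]] := nabla_norm_near g X iz.
have [d d0 Hd] := path_chart (cx _ suv) iz r0.
exists d => // a b _ _ sa as_ sb bs; exists K => t /andP[at_ tb].
have [iy yd] := Hd t (lt_le_trans sa at_) (le_lt_trans tb bs).
exact: HK.
Qed.

Definition pnorm p q := cnorm g (chart_at p) p q.

(* The slack e' absorbs the chart changes and is at our disposal once u and v are
   fixed; this makes the statement transitive in (u, v), so that it follows from
   its local form. *)
Lemma flow_growth (C e : R) x u v : 0 < e -> u <= v -> runs x u v ->
  (forall t, u <= t <= v -> nabla_norm g X (x t) <= C) ->
  forall (e' : R) (V : set M), 0 < e' -> nbhs (x v) V ->
  exists B, \forall q \near x u, forall y, runs y u v -> y u = q ->
    [/\ V (y v), pnorm (x v) (y v) <= expR ((C + e) * (v - u) + e') * pnorm (x u) (y u) &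
      forall t, u <= t <= v -> nabla_norm g X (y t) <= B].
Proof.
move=> e0 uv xr xC.
pose P a b := forall (e' : R) (V : set M), 0 < e' -> nbhs (x b) V ->
  exists B, \forall q \near x a, forall y, runs y a b -> y a = q ->
    [/\ V (y b), pnorm (x b) (y b) <= expR ((C + e) * (b - a) + e') * pnorm (x a) (y a) &
      forall t, a <= t <= b -> nabla_norm g X (y t) <= B].
apply: (@cousin R P) => //.
  move=> a b c ua ab bc cv Pab Pbc e' V e'0 Vc.
  have e'2 : 0 < e' / 2 by rewrite divr_gt0.
  (* Neighbourhoods are pulled back in time: the one obtained at [x b] for [b, c] is the target
     prescribed for [a, b]. *)
  have [B2 N2] := Pbc _ _ e'2 Vc.
  have [B1 N1] := Pab _ _ e'2 N2.
  exists (Num.max B1 B2); apply: filterS N1 => q Hq y yr yq.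
  have [|//|Hb yb1 yB1] := Hq y; first exact: runs_sub yr.
  have [|//|Vy yb2 yB2] := Hb y; first exact: runs_sub yr.
  split => //.
    apply: le_trans yb2 _.
    have -> : (C + e) * (c - a) + e' = ((C + e) * (c - b) + e' / 2) + ((C + e) * (b - a) + e' / 2).
      by field.
    by rewrite [X in _ <= X * _]expRD -mulrA ler_wpM2l ?expR_ge0.
  move=> t /andP[at_ tc]; rewrite le_max; have [tb|bt] := leP t b.
    by rewrite yB1// at_ tb.
  by rewrite yB2 ?orbT// (ltW bt).
move=> s suv; set i := chart_at (x s); have ix : mdom i (x s) by exact: chart_atP.
have [r r0 [B HB]] := local_growth ix e0.
have [d d0 Hd] := path_chart (xr _ suv).1 ix r0.
exists d => // a b ua bv sa as_ sb bs e' V e'0 Vb.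
have ab : a <= b by exact: le_trans sb.
have xr' : runs x a b by exact: runs_sub xr.
have Hx t : a <= t <= b ->
    [/\ mdom i (x t), `|mmap i (x t) - mmap i (x s)| < r & nabla_norm g X (x t) <= C].
  move=> /andP[at_ tb].
  have [iy yd] := Hd t (lt_le_trans sa at_) (le_lt_trans tb bs).
  by split => //; apply: xC; rewrite (le_trans ua)// (le_trans tb).
have e'2 : 0 < e' / 2 by rewrite divr_gt0.
have [ixa _ _] := Hx a (ltac:(by rewrite lexx)).
have [ixb _ _] := Hx b (ltac:(by rewrite ab lexx)).
(* Two changes of chart, from the selected chart at [x a] into i and from i into the one at [x b],
   cost e' / 2 each. *)
have Nb := cnorm_change g ixb (chart_atP (x b)) e'2.
have Na := cnorm_change g (chart_atP (x a)) ixa e'2.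
have [rho rho0 Hrho] := chart_nbhs ixb (filterI Nb Vb).
have N := HB C x a b ab xr' Hx rho rho0.
exists B; apply: filterS (filterI Na N) => q [Nq Hq] y yr yq.
have [yB iyb yrho yle] := Hq y yr yq.
have [Nyb Vyb] := Hrho _ iyb yrho.
split => //.
apply: le_trans Nyb _.
have -> : (C + e) * (b - a) + e' = e' / 2 + ((C + e) * (b - a) + e' / 2) by field.
rewrite [X in _ <= X * _]expRD -mulrA ler_wpM2l ?expR_ge0//; apply: le_trans yle _.
by rewrite [X in _ <= X * _]expRD -mulrA ler_wpM2l ?expR_ge0// yq.
Qed.

(* [flow_growth] with pnorm (x u) (y u) = 0. *)
Lemma runs_unique x y u v : u <= v -> runs x u v -> runs y u v -> x u = y u -> x v = y v.
Proof.
move=> uv xr yr xy.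
have [C HC] := nabla_norm_path_bounded uv (fun t h => (xr t h).1).
have [B N] := flow_growth ltr01 uv xr HC ltr01 (nbhs_mdom (chart_atP (x v))).
have [//|iy le0 _] := nbhs_singleton N y yr.
apply/esym/(cnorm_eq0 (chart_atP (x v)) iy); apply: le_trans le0 _.
by rewrite -xy /pnorm /cnorm subrr /gn /qf !mul0mx mxE sqrtr0 mulr0.
Qed.

End FlowGrowth.

(** * Speed and short curves *)

Lemma continuous_sum {R : realType} (T : topologicalType) m (F : 'I_m -> T -> R) (t : T) :
  (forall a, {for t, continuous (F a)}) -> {for t, continuous (fun s => \sum_a F a s)}.
Proof.
move=> cF; have -> : (fun s => \sum_a F a s) = \sum_a F a.
  by apply/funext => s; rewrite fct_sumE.
elim/big_ind : _ => [|f h cf ch|a _]; last exact: cF.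
- exact: cst_continuous.
- exact: continuousD cf ch.
Qed.

Section CurveSpeed.
Context {R : realType} {n : nat} (M : manifold R n) (g : metric M).
Implicit Types (i j : cidx M) (p q : M) (c : R -> M) (J : set R) (t : R).

Lemma derive1_chart_change c t i j : {for t, continuous c} -> mdom i (c t) -> mdom j (c t) ->
  derivable (mmap i \o c) t 1 ->
  derive1 (mmap j \o c) t = derive1 (mmap i \o c) t *m pjac (mtrans i j) (mmap i (c t)).
Proof.
move=> cc ic jc dc.
have d := mtrans_differentiable (overlap_mmap ic jc).
have [_ D] := is_derive_along d (derivableP dc).
rewrite !derive1E -(pjacE _ d) -D.
apply: near_eq_derive; near=> s; rewrite /= mtrans_mmap//.
by near: s; exact: (cc _ (nbhs_mdom ic)).
Unshelve. all: by end_near. Qed.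

Lemma speedE c t i : {for t, continuous c} -> mdom i (c t) ->
  derivable (mmap i \o c) t 1 ->
  speed g c t = gn (gcoef g i (mmap i (c t))) (derive1 (mmap i \o c) t).
Proof.
move=> cc ic dc; have jc := chart_atP (c t).
rewrite /speed /Defs.gnorm -/(qf _ _ _) -/(gn _ _) (derive1_chart_change cc ic jc dc).
by rewrite (gn_change g _ (overlap_mmap ic jc)) mtrans_mmap.
Qed.

Lemma gn_continuous (G : R -> 'M[R]_n) (w : R -> 'rV[R]_n) t :
  {for t, continuous G} -> {for t, continuous w} ->
  {for t, continuous (fun s => gn (G s) (w s))}.
Proof.
move=> cG cw.
have cw' a : {for t, continuous (fun s => w s 0 a)}.
  apply: (@continuous_comp _ _ _ w (fun z : 'rV[R]_n => z 0 a)) => //.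
  exact: coord_continuous.
have cG' a b : {for t, continuous (fun s => G s a b)}.
  apply: (@continuous_comp _ _ _ G (fun z : 'M[R]_n => z a b)) => //.
  exact: coord_continuous.
apply: (@continuous_comp _ _ _ (fun s => qf (G s) (w s) (w s)) (@Num.sqrt R)); last exact: sqrt_continuous.
have -> : (fun s => qf (G s) (w s) (w s)) =
  (fun s => \sum_(a < n) \sum_(b < n) w s 0 a * w s 0 b * G s a b).
  by apply/funext => s; exact: qfE.
apply: continuous_sum => a; apply: continuous_sum => b.
by apply: cvgM; [apply: cvgM; exact: cw'|exact: cG'].
Qed.

(** The chart selected at [c s] may jump with s; near t, [speedE] rewrites the speed in one fixed
    chart. *)
Lemma speed_continuous c J t : curve_C1_on c J -> J t -> {for t, continuous (speed g c)}.
Proof.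
move=> [oJ cJ] Jt; have [cc Hc] := cJ _ Jt.
set i := chart_at (c t); have ic : mdom i (c t) by exact: chart_atP.
have [dc ddc] := Hc _ ic.
have N : \forall s \near t, speed g c s =
   gn (gcoef g i (mmap i (c s))) (derive1 (mmap i \o c) s).
  near=> s; have is_ : mdom i (c s) by near: s; exact: (cc _ (nbhs_mdom ic)).
  have [cs Hs] : {for s, continuous c} /\ forall i, mdom i (c s) ->
      derivable (mmap i \o c) s 1 /\ {for s, continuous (derive1 (mmap i \o c))}.
    by apply: cJ; near: s; exact: open_nbhs_nbhs.
  exact: (speedE cs is_ (Hs _ is_).1).
have cR : {for t, continuous (fun s => gn (gcoef g i (mmap i (c s))) (derive1 (mmap i \o c) s))}.
  apply: gn_continuous => //.
  apply: (@continuous_comp _ _ _ (mmap i \o c) (gcoef g i)).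
    by apply: continuous_comp => //; exact: cmap_continuous.
  apply: differentiable_continuous.
  exact: (smooth_mx_differentiable (gcoef_smooth_mx g i) (mimg_mmap ic)).
change (speed g c s @[s --> t] --> speed g c t); rewrite (nbhs_singleton N).
apply: cvg_trans cR; apply: near_eq_cvg.
by apply: filterS N => s ->.
Unshelve. all: by end_near. Qed.

Lemma speed_ge0 c t : 0 <= speed g c t.
Proof. exact: sqrtr_ge0. Qed.

Lemma geodesic_C1 c J : geodesic_on g c J -> curve_C1_on c J.
Proof.
move=> [oJ H]; split; first exact: oJ.
move=> t Jt; have [cc Hc] := H _ Jt; split; first exact: cc.
move=> i ic; have [dc ddc _] := Hc _ ic; split; first exact: dc.
apply: differentiable_continuous.
by apply/derivable1_diffP; exact: ddc.
Qed.

Lemma C1_translate c J (b : R) : curve_C1_on c J ->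
  curve_C1_on (fun t => c (t - b)) [set t | J (t - b)].
Proof.
move=> [oJ H]; have cs : continuous (fun t : R => t - b).
  by move=> t; apply: cvgB; [exact: cvg_id|exact: cvg_cst].
split; first by apply: open_comp => // t _; exact: cs.
move=> t Jt; have [cc Hc] := H _ Jt; split.
  by apply: (@continuous_comp _ _ _ (fun t => t - b) c) => //; exact: cs.
move=> i ic; have [dc ddc] := Hc _ ic.
have E : derive1 (mmap i \o (fun t => c (t - b))) = derive1 (mmap i \o c) \o (fun t => t - b).
  apply/funext => s; rewrite /= !derive1E.
  exact: (derive_translate (mmap i \o c) (- b) s 1).
have dd : differentiable (mmap i \o c) (t - b) by apply/derivable1_diffP; exact: dc.
have dd' := differentiable_translate dd.
split; first by apply/derivable1_diffP; exact: dd'.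
rewrite E.
apply: (@continuous_comp _ _ _ (fun t => t - b) (derive1 (mmap i \o c))); first exact: cs.
exact: ddc.
Qed.

Lemma speed_translate c (b t : R) : speed g (fun t => c (t - b)) t = speed g c (t - b).
Proof.
rewrite /speed; congr (Defs.gnorm _ _ _ _); rewrite !derive1E.
exact: (derive_translate (mmap _ \o c) (- b) t 1).
Qed.

Lemma near_eq_speed c c' t : (\forall s \near t, c s = c' s) -> speed g c t = speed g c' t.
Proof.
move=> N; rewrite /speed (nbhs_singleton N); congr (Defs.gnorm _ _ _ _).
by rewrite !derive1E; apply: near_eq_derive; apply: filterS N => s /= ->.
Qed.

(** The unit parameter interval makes the speed bound l a length bound. *)
Definition C1_piece p q (l : R) := exists c J, [/\ `[0, 1] `<=` J, curve_C1_on c J,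
  c 0 = p, c 1 = q & forall t, 0 <= t <= 1 -> speed g c t <= l].

Lemma mimgK i z : mimg i z -> mmap i (cinv (atlas i) z) = z.
Proof. by move=> [q iq <-]; rewrite mmapK. Qed.

Lemma mdom_cinv i z : mimg i z -> mdom i (cinv (atlas i) z).
Proof. by move=> [q iq <-]; rewrite mmapK. Qed.

Lemma straight_C1 i (z w : 'rV[R]_n) J : open J -> (forall t, J t -> mimg i (z + t *: w)) ->
  curve_C1_on (fun t => cinv (atlas i) (z + t *: w)) J.
Proof.
move=> oJ HJ; pose line : R -> 'rV[R]_n := fun t => z + t *: w.
have dl t : is_derive t 1 line w by exact: is_derive_line.
have ddl t : differentiable line t.
  by apply/derivable1_diffP; have [] := dl t.
have cl t : {for t, continuous line} by apply: differentiable_continuous; exact: ddl.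
split => // t Jt; split.
  apply: (@continuous_comp _ _ _ line (cinv (atlas i))); first exact: cl.
  exact: (cinv_continuous (HJ _ Jt)).
move=> j jc.
have ov : overlap (atlas i) (atlas j) (line t).
  exists (cinv (atlas i) (line t)); last exact: mimgK (HJ _ Jt).
  by split => //; exact: mdom_cinv (HJ _ Jt).
have D s : overlap (atlas i) (atlas j) (line s) ->
    is_derive s 1 (mmap j \o (fun t => cinv (atlas i) (z + t *: w))) (w *m pjac (mtrans i j) (line s)).
  move=> os; have d := mtrans_differentiable os.
  by rewrite -pjacE//; exact: (is_derive_along d (dl s)).
have [dc _] := D _ ov; split; first exact: dc.
have N : \forall s \near t, derive1 (mmap j \o (fun t => cinv (atlas i) (z + t *: w))) s =
   w *m pjac (mtrans i j) (line s).
  near=> s; have os : overlap (atlas i) (atlas j) (line s).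
    near: s; apply: (cl t); apply: open_nbhs_nbhs; split => //; exact: overlap_open.
  by rewrite derive1E; have [_ ->] := D _ os.
set f := derive1 _; change (f s @[s --> t] --> f t); rewrite /f (nbhs_singleton N).
have cR : {for t, continuous (fun s => w *m pjac (mtrans i j) (line s))}.
  have dP := smooth_mx_differentiable (smooth_mx_pjac (mtrans_smooth i j)) ov.
  have dPl : derivable (pjac (mtrans i j) \o line) t 1.
    by apply/derivable1_diffP; apply: differentiable_comp => //; exact: ddl.
  have [dd _] := derivable_mulmx (derivable_cst w t 1) dPl.
  by apply: differentiable_continuous; apply/derivable1_diffP; exact: dd.
apply: cvg_trans cR; apply: near_eq_cvg.
by apply: filterS N => s ->.
Unshelve. all: by end_near. Qed.

Lemma straight_piece i p0 (e : R) : mdom i p0 -> 0 < e ->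
  exists2 r : R, 0 < r & forall p q, mdom i p -> mdom i q ->
    `|mmap i p - mmap i p0| < r -> `|mmap i q - mmap i p0| < r ->
    C1_piece p q (expR e * gn (gcoef g i (mmap i p0)) (mmap i q - mmap i p)).
Proof.
move=> ip e0; set z0 := mmap i p0.
have iz : mimg i z0 by exact: mimg_mmap.
have pG := gcoef_is_posdef g iz.
have [d d0 Hd] := posdef_near (@mimg_open _ _ M i) (gcoef_smooth_mx g i) iz pG e0.
(* The segment is extended to the parameters ]-1, 2[ to have an open domain. Its direction is
   shorter than 2d/5, so it stays within d/5 + 2 (2d/5) = d of [z0]. *)
have r0 : 0 < d / 5 by rewrite divr_gt0.
exists (d / 5) => // p q jp jq pr qr.
set z := mmap i p; set w := mmap i q - mmap i p.
have wr : `|w| < 2 * (d / 5).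
  have -> : w = (mmap i q - z0) - (mmap i p - z0) by rewrite opprB addrA subrK.
  by rewrite (le_lt_trans (ler_normB _ _))// mulr2n mulrDl mul1r ltrD.
have HJ (t : R) : -1 < t < 2 -> `|z + t *: w - z0| < d.
  move=> /andP[t1 t2]; rewrite addrAC; apply: le_lt_trans (ler_normD _ _) _.
  have tw : `|t *: w| <= 2 * `|w|.
    by rewrite normrZ ler_wpM2r// ler_norml; apply/andP; split; lra.
  apply: le_lt_trans (lerD (ltW pr) tw) _; lra.
have oJ : open `]-1, (2:R)[%classic by exact: interval_open.
have JC := @straight_C1 i z w `]-1, 2[%classic oJ _.
have {}JC : curve_C1_on (fun t => cinv (atlas i) (z + t *: w)) `]-1, 2[%classic.
  by apply: JC => t; rewrite /= in_itv/= => /HJ /Hd[].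
exists (fun t => cinv (atlas i) (z + t *: w)), `]-1, 2[%classic; split => //.
- by move=> t /=; rewrite !in_itv/= => /andP[? ?]; apply/andP; split; lra.
- by rewrite scale0r addr0 mmapK.
- by rewrite scale1r /w addrC subrK mmapK.
move=> t /andP[t0 t1].
have tJ : -1 < t < 2 by apply/andP; split; lra.
have [izt _ Gq] := Hd _ (HJ _ tJ).
have [cc Hc] := JC.2 t tJ.
have ic := mdom_cinv izt.
rewrite (speedE cc ic (Hc _ ic).1) mimgK//.
have -> : derive1 (mmap i \o (fun t => cinv (atlas i) (z + t *: w))) t = w.
  have [_ E] := is_derive_line z w t; rewrite derive1E.
  apply: etrans E; apply: near_eq_derive; near=> s; rewrite /= mimgK//.
  have /HJ/Hd[] // : -1 < s < 2.
  near: s; apply: open_nbhs_nbhs; split; first exact: oJ.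
  exact: tJ.
rewrite -[X in X * _]ger0_norm ?expR_ge0// -sqrtr_sqr -sqrtrM ?sqr_ge0//.
rewrite ler_sqrt ?mulr_ge0 ?sqr_ge0 ?posdef_ge0//.
have qw : 0 <= qf (gcoef g i z0) w w by exact: posdef_ge0.
apply: (@le_trans _ _ ((1 + e) * qf (gcoef g i z0) w w)).
  have := Gq w; rewrite ler_norml => /andP[_].
  by rewrite mulrDl mul1r lerBlDl.
rewrite ler_wpM2r//; apply: le_trans (expR_ge1Dx e) _.
by rewrite expr2 ler_peMr ?expR_ge0// (le_trans _ (expR_ge1Dx e))// lerDl ltW.
Unshelve. all: by end_near. Qed.

End CurveSpeed.

(** * Subdivisions and integrals over open intervals *)

Section PathOrder.
Context {R : realType}.

Lemma path_lt_last (x : R) s : path <%R x s -> x <= last x s.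
Proof.
elim: s x => //= y s IH x /andP[xy /IH]; apply: le_trans; exact: ltW.
Qed.

Lemma path_nth_le_last (x d : R) s k : path <%R x s -> (k < size s)%N ->
  nth d s k <= last x s.
Proof.
elim: s x k => //= y s IH x [|k] /andP[_ ys] ks /=; first exact: path_lt_last.
exact: IH.
Qed.

Lemma continuous_measurable_itv (f : R -> R) (i : interval R) :
  {in i, forall t, {for t, continuous f}} -> measurable_fun [set` i] f.
Proof.
move=> cf; apply: subspace_continuous_measurable_fun; first exact: measurable_itv.
by apply: continuous_in_subspaceT => t; rewrite inE => ti; exact: cf.
Qed.

Local Notation mu := (@lebesgue_measure R).

(** The break point b is a null set, so the value of f there, arbitrary for the speed of a glued
    curve, does no harm. *)
Lemma integral_oo_split (f : R -> R) (a b c : R) : (forall t, 0 <= f t) ->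
  measurable_fun `]a, b[ f -> measurable_fun `]b, c[ f ->
  measurable_fun `]a, c[ f /\
  (\int[mu]_(t in `]a, c[) (f t)%:E <=
   \int[mu]_(t in `]a, b[) (f t)%:E + \int[mu]_(t in `]b, c[) (f t)%:E)%E.
Proof.
move=> f0 m1 m2.
have mA : measurable (`]a, b[ : set R) by exact: measurable_itv.
have mB : measurable ([set b] : set R) by exact: measurable_set1.
have mC : measurable (`]b, c[ : set R) by exact: measurable_itv.
have mBC : measurable ([set b] `|` `]b, c[ : set R) by exact: measurableU.
have mABC : measurable (`]a, b[ `|` ([set b] `|` `]b, c[) : set R) by exact: measurableU.
have mf1 : measurable_fun ([set b] `|` `]b, c[) f.
  apply/(measurable_funU _ mB mC); split; [exact: measurable_fun_set1|exact: m2].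
have mf2 : measurable_fun (`]a, b[ `|` ([set b] `|` `]b, c[)) f.
  by apply/(measurable_funU _ mA mBC); split; [exact: m1|exact: mf1].
have sub : (`]a, c[ : set R) `<=` `]a, b[ `|` ([set b] `|` `]b, c[).
  move=> t /=; rewrite !in_itv/= => /andP[t0 t1].
  by have [tb|bt|->] := ltgtP t b; [left; rewrite t0|right; right|right; left].
have pf (D : set R) (t : R) : D t -> (0 <= (f t)%:E)%E by rewrite lee_fin.
split; first exact: (measurable_funS mABC sub mf2).
have me1 : measurable_fun ([set b] `|` `]b, c[) (EFin \o f) by apply/measurable_EFinP; exact: mf1.
have me2 : measurable_fun (`]a, b[ `|` ([set b] `|` `]b, c[)) (EFin \o f).
  by apply/measurable_EFinP; exact: mf2.
have mAC : measurable (`]a, c[ : set R) by exact: measurable_itv.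
apply: le_trans (ge0_subset_integral mu mAC mABC me2 (pf _) sub) _.
have d1 : [disjoint `]a, b[ & [set b] `|` `]b, c[]%classic.
  apply/disj_setPS => t /= [].
  rewrite !in_itv/= => /andP[_ tb] [E|/andP[bt _]]; first by rewrite E ltxx in tb.
  by rewrite ltNge (ltW bt) in tb.
rewrite (ge0_integral_setU mu mA mBC me2 (pf _) d1).
have d2 : [disjoint [set b] & `]b, c[]%classic.
  by apply/disj_setPS => t /= [->]; rewrite in_itv/= ltxx.
rewrite (ge0_integral_setU mu mB mC me1 (pf _) d2).
by rewrite integral_set1 add0e.
Qed.

Lemma integral_oo_le (f : R -> R) (a b K : R) : (forall t, 0 <= f t) -> a <= b ->
  measurable_fun `]a, b[ f -> (forall t, a < t < b -> f t <= K) ->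
  (\int[mu]_(t in `]a, b[) (f t)%:E <= (K * (b - a))%:E)%E.
Proof.
move=> f0 ab mf fK.
have mA : measurable (`]a, b[ : set R) by exact: measurable_itv.
have [->|nab] := eqVneq a b.
  by rewrite set_itvoo0 integral_set0 subrr mulr0.
have ab' : a < b by rewrite lt_neqAle nab.
apply: (@le_trans _ _ (\int[mu]_(t in `]a, b[) (cst K%:E t))%E).
  have h0 (t : R) : `]a, b[%classic t -> (0 <= (f t)%:E)%E by rewrite lee_fin.
  have h1 : measurable_fun `]a, b[ (fun t => (f t)%:E) by apply/measurable_EFinP.
  have h2 : measurable_fun `]a, b[ (cst K%:E) by exact: measurable_cst.
  have h3 (t : R) : `]a, b[%classic t -> ((f t)%:E <= cst K%:E t)%E.
    by rewrite /= in_itv/= => tab; rewrite lee_fin fK.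
  exact: (ge0_le_integral mu mA h0 h1 h2 h3).
have E := @lebesgue_measure_itv R `]a, b[; rewrite /= lte_fin ab' -EFinB in E.
by rewrite (integral_cst mu mA K%:E) /= EFinM -E.
Qed.

End PathOrder.

(** * Concatenation of curves *)

Section Chains.
Context {R : realType} {n : nat} (M : manifold R n) (g : metric M).
Implicit Types (p q r : M) (c : R -> M) (l : R).
Local Notation mu := (@lebesgue_measure R).

(** A competitor in [rdist] whose length bound is kept as an extended-real integral; together with
    measurability this rules out a length that is finite only by default. *)
Definition reach p q l := exists c b, [/\ 0 <= b, piecewise_C1 c 0 b, c 0 = p, c b = q &
  measurable_fun `]0, b[ (speed g c) /\
  (\int[mu]_(t in `]0%R, b[) (speed g c t)%:E <= l%:E)%E].

Lemma reach_refl p : reach p p 0.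
Proof.
exists (cst p), 0; split => //; last first.
  by rewrite set_itvoo0; split; [exact: measurable_fun_set0|rewrite integral_set0].
split; last by exists [::].
by apply: continuous_subspaceT; exact: cst_continuous.
Qed.

Lemma reach_step p r q l l' : reach p r l -> C1_piece g r q l' -> reach p q (l + l').
Proof.
move=> [c [b [b0 [cc [s [sp sl sC]]] cp cr [mc ic]]]] [c2 [J [J01 cJ c20 c21 c2l]]].
pose c3 (t : R) := c2 (t - b).
pose J3 := [set t | J (t - b)].
have c3J : curve_C1_on c3 J3 by exact: C1_translate.
have J3b (t : R) : b <= t <= b + 1 -> J3 t.
  by move=> /andP[bt tb]; apply: J01; rewrite /= in_itv/= subr_ge0 bt lerBlDl.
pose c' (t : R) := if t <= b then c t else c3 t.
have c'l (t : R) : t <= b -> c' t = c t by rewrite /c' => ->.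
have c'r (t : R) : b <= t -> c' t = c3 t.
  rewrite /c' => bt; case: ifP => // tb.
  have -> : t = b by apply/eqP; rewrite eq_le tb.
  by rewrite /c3 subrr cr c20.
(* The speeds agree only off b, where the derivative of the glued curve would mix both sides. *)
have sl' (t : R) : t < b -> speed g c' t = speed g c t.
  move=> tb; apply: near_eq_speed; near=> u; apply: c'l; apply: ltW.
  by near: u; exact: lt_nbhsl.
have sr' (t : R) : b < t -> speed g c' t = speed g c3 t.
  move=> tb; apply: near_eq_speed; near=> u; apply: c'r; apply: ltW.
  by near: u; exact: lt_nbhsr.
have b01 : 0 <= b + 1 by rewrite addr_ge0.
have c'within : {within `[0, b + 1], continuous c'}.
  have -> : `[0, b + 1]%classic = `[0, b]%classic `|` `[b, b + 1]%classic :> set R.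
    apply/seteqP; split=> t /=; rewrite !in_itv/=.
      by move=> /andP[t0 tb]; have [tb'|/ltW tb'] := leP t b; [left|right]; rewrite ?t0 ?tb'.
    by move=> [|] /andP[t1 t2]; apply/andP; split; lra.
  apply: withinU_continuous; [exact: interval_closed|exact: interval_closed| |].
    apply: subspace_eq_continuous cc => t; rewrite inE/= in_itv/= => /andP[_ tb].
    by rewrite -[LHS]/(c t) -[RHS]/(c' t) c'l.
  apply: (@subspace_eq_continuous _ _ _ c3).
    move=> t; rewrite inE/= in_itv/= => /andP[tb _].
    by rewrite -[LHS]/(c3 t) -[RHS]/(c' t) c'r.
  apply: continuous_in_subspaceT => t; rewrite inE/= in_itv/= => tb.
  exact: (c3J.2 _ (J3b _ tb)).1.
have c'pw : piecewise_C1 c' 0 (b + 1).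
  split; first exact: c'within.
  exists (rcons s (b + 1)); split.
  + by rewrite rcons_path sp sl ltrDl ltr01.
  + by rewrite last_rcons.
  + move=> k; rewrite size_rcons ltnS leq_eqVlt => /predU1P[->|ks].
      rewrite -rcons_cons !nth_rcons/= ltnn eqxx ltnS leqnn -last_nth sl.
      exists J3, c3; split; [|exact: c3J|].
        by move=> t /=; rewrite in_itv/=; exact: J3b.
      by move=> t /andP[bt _]; exact: c'r.
    rewrite -rcons_cons !nth_rcons/= ltnS (ltnW ks) ks.
    have [J1 [c1 [sub1 C1 E1]]] := sC k ks.
    exists J1, c1; split; [exact: sub1|exact: C1|].
    move=> t tk; rewrite -E1//; apply: c'l.
    case/andP: tk => _ /le_trans; apply; rewrite -sl; exact: path_nth_le_last.
exists c', (b + 1); split; [exact: b01|exact: c'pw|by rewrite c'l| |].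
  by rewrite c'r ?lerDl// /c3 addrAC subrr add0r.
have m1 : measurable_fun `]0, b[ (speed g c').
  apply: eq_measurable_fun mc => t; rewrite inE/= in_itv/= => /andP[_ tb].
  by rewrite sl'.
have m2 : measurable_fun `]b, b + 1[ (speed g c').
  apply: (@eq_measurable_fun _ _ _ _ _ (speed g c3)).
    by move=> t; rewrite inE/= in_itv/= => /andP[tb _]; rewrite sr'.
  apply: continuous_measurable_itv => t; rewrite in_itv/= => /andP[t1 t2].
  by apply: speed_continuous c3J _; apply: J3b; rewrite !ltW.
have [m3 i3] := integral_oo_split (speed_ge0 g c') m1 m2.
split; first exact: m3.
apply: le_trans i3 _; rewrite EFinD; apply: leeD.
  apply: le_trans ic; rewrite le_eqVlt; apply/orP; left; apply/eqP.
  by apply: eq_integral => t; rewrite inE/= in_itv/= => /andP[_ tb]; rewrite sl'.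
have bb1 : b <= b + 1 by rewrite lerDl.
have i4 : forall t, b < t < b + 1 -> speed g c' t <= l'.
  move=> t /andP[bt tb]; rewrite sr'// /c3 speed_translate; apply: c2l.
  by rewrite subr_ge0 (ltW bt)/= lerBlDl ltW.
have := integral_oo_le (speed_ge0 g c') bb1 m2 i4.
by rewrite addrAC subrr add0r mulr1.
Unshelve. all: by end_near. Qed.

(** [reach_step] appends one piece only; the inductive form allows two chains to be concatenated, as
    the transitivity in [cousin] demands. *)
Inductive chain p : M -> R -> Prop :=
| chain_nil : chain p p 0
| chain_cons r q l l' : chain p r l -> C1_piece g r q l' -> chain p q (l + l').

Lemma chain_cat p q r l l' : chain p q l -> chain q r l' -> chain p r (l + l').
Proof.
move=> pq; elim=> [|r1 q1 l1 l1' _ IH pc]; first by rewrite addr0.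
by rewrite addrA; apply: chain_cons pc.
Qed.

Lemma chain_reach p q l : chain p q l -> reach p q l.
Proof.
by elim=> [|r1 q1 l1 l1' _ IH pc]; [exact: reach_refl|exact: reach_step pc].
Qed.

Lemma reach_rdist p q l : reach p q l -> rdist g p q <= l.
Proof.
move=> [c [b [b0 pc cp cq [mc ic]]]].
apply: (@le_trans _ _ (curve_length g c 0 b)).
  apply: ge_inf; last by exists c, 0, b.
  by exists 0 => _ [c' [a' [b' [_ _ _ _ ->]]]]; apply: Rintegral_ge0 => t _; exact: speed_ge0.
rewrite /curve_length /Rintegral -lee_fin.
have E : (\int[mu]_(t in `[0%R, b]) (speed g c t)%:E = \int[mu]_(t in `]0%R, b[) (speed g c t)%:E)%E.
  by apply: integral_itv_bndoo; exact/measurable_EFinP.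
rewrite E fineK//.
have i0 : (0 <= \int[mu]_(t in `]0%R, b[) (speed g c t)%:E)%E.
  by apply: integral_ge0 => t _; rewrite lee_fin speed_ge0.
by rewrite ge0_fin_numE// (le_lt_trans ic)// ltry.
Qed.

End Chains.

(** * First-order behaviour and length of a C^1 curve *)

Section CurvePrimitive.
Context {R : realType} {n : nat} (M : manifold R n) (g : metric M).
Implicit Types (c : R -> M) (J : set R).

Lemma derivable_littleo (V : normedModType R) (f : R -> V) (s : R) : derivable f s 1 ->
  forall e : R, 0 < e -> exists2 d : R, 0 < d &
    forall t, `|t - s| < d -> `|f t - f s - (t - s) *: derive1 f s| <= e * `|t - s|.
Proof.
move=> df e e0.
have df' : differentiable f s by apply/derivable1_diffP.
have [d d0 H] := diff_littleo df' e0; exists d => // t td.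
by have := H _ td; rewrite diff1E//; have -> : s + (t - s) = t by rewrite addrC subrK.
Qed.

Lemma pnorm_curve c J s : curve_C1_on c J -> J s -> forall e : R, 0 < e ->
  exists2 d : R, 0 < d & forall t, `|t - s| < d ->
    pnorm g (c s) (c t) <= (speed g c s + e) * `|t - s|.
Proof.
move=> cJ Js e e0; have [cc Hc] := cJ.2 s Js.
have ic := chart_atP (c s); have [dc _] := Hc _ ic.
set i := chart_at (c s) in ic dc *.
pose L := Num.sqrt (n%:R ^+ 2 * `|gcoef g i (mmap i (c s))|) + 1.
have L0 : 0 < L by rewrite ltr_wpDl// sqrtr_ge0.
have [d d0 H] := derivable_littleo dc (divr_gt0 e0 L0).
exists d => // t td; have := H t td; rewrite /=.
set D := derive1 _ s; set rho := _ - _ - _ => rhole.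
rewrite /pnorm -/i /cnorm.
have -> : mmap i (c t) - mmap i (c s) = (t - s) *: D + rho by rewrite /rho [RHS]addrC subrK.
apply: le_trans (gnD _ _ (gcoef_is_posdef g (mimg_mmap ic))) _.
rewrite gnZ -(speedE g cc ic dc) mulrDl [`|t - s| * _]mulrC lerD2l.
apply: le_trans (gn_le_norm _ _) _.
apply: (@le_trans _ _ (L * (e / L * `|t - s|))).
  by apply: ler_pM => //; rewrite lerDl.
by rewrite mulrA mulrCA divff ?mulr1// gt_eqF.
Qed.

(** Phi makes length additive in the parameter and gives two-sided first-order expansions at every
    point of [a, b], including the ends. *)
Lemma speed_primitive c J (a b : R) : curve_C1_on c J -> `[a, b] `<=` J -> a <= b ->
  exists Phi : R -> R, (forall s, a <= s <= b -> is_derive s 1 Phi (speed g c s)) /\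
    curve_length g c a b = Phi b - Phi a.
Proof.
move=> cJ abJ ab.
have Ja : J a by apply: abJ; rewrite /= in_itv/= lexx.
have Jb : J b by apply: abJ; rewrite /= in_itv/= ab lexx.
have [d1 d10 H1] : exists2 d : R, 0 < d & forall t, `|t - a| < d -> J t.
  have /nbhs_ballP[d d0 Hd] : nbhs a J by apply: open_nbhs_nbhs; split => //; exact: cJ.1.
  by exists d => // t td; apply: Hd; rewrite -ball_normE/= distrC.
have [d2 d20 H2] : exists2 d : R, 0 < d & forall t, `|t - b| < d -> J t.
  have /nbhs_ballP[d d0 Hd] : nbhs b J by apply: open_nbhs_nbhs; split => //; exact: cJ.1.
  by exists d => // t td; apply: Hd; rewrite -ball_normE/= distrC.
(* The openness of J leaves room beyond a and b, so that the fundamental theorem applies at both end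
   points. *)
pose a0 := a - d1 / 2; pose b0 := b + d2 / 2.
have J0 t : a0 <= t <= b0 -> J t.
  move=> /andP[t1 t2]; have [ta|at_] := ltP t a.
    by apply: H1; rewrite ltr_norml; apply/andP; split; rewrite /a0 in t1; lra.
  have [tb|bt] := leP t b; first by apply: abJ; rewrite /= in_itv/= at_.
  by apply: H2; rewrite ltr_norml; apply/andP; split; rewrite /b0 in t2; lra.
have a0a : a0 < a by rewrite /a0; lra.
have bb0 : b < b0 by rewrite /b0; lra.
have cs t : a0 <= t <= b0 -> {for t, continuous (speed g c)}.
  by move=> /J0; exact: speed_continuous.
have int0 : (@lebesgue_measure R).-integrable `[a0, b0] (EFin \o speed g c).
  apply: continuous_compact_integrable; first exact: segment_compact.
  by apply: continuous_in_subspaceT => t; rewrite inE/= in_itv/=; exact: cs.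
pose Phi s := \int[@lebesgue_measure R]_(t in `[a0, s]) speed g c t.
have D s : a <= s <= b -> is_derive s 1 Phi (speed g c s).
  move=> /andP[as_ sb].
  have sb0 : s < b0 by exact: le_lt_trans bb0.
  have a0s : a0 < s by exact: lt_le_trans as_.
  have [|d e] := continuous_FTC1_closed sb0 int0 a0s _.
    by apply: cs; rewrite !ltW.
  by rewrite derive1E in e; exact: DeriveDef d e.
exists Phi; split => //.
have [<-|nab] := eqVneq a b.
  by rewrite subrr /curve_length set_itv1 Rintegral_set1.
have ab' : a < b by rewrite lt_neqAle nab.
have cPhi s : a <= s <= b -> {for s, continuous Phi}.
  by move=> /D[dd _]; apply: differentiable_continuous; apply/derivable1_diffP.
have cw : {within `[a, b], continuous (speed g c)}.
  apply: continuous_in_subspaceT => t; rewrite inE/= in_itv/= => /andP[t1 t2].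
  by apply: cs; rewrite (le_trans (ltW a0a))// (le_trans t2)// ltW.
have LR : derivable_oo_LRcontinuous Phi a b.
  split.
  - by move=> t; rewrite in_itv/= => /andP[t1 t2]; have [|] := D t; first by rewrite !ltW.
  - by apply: cvg_at_right_filter; apply: cPhi; rewrite lexx.
  - by apply: cvg_at_left_filter; apply: cPhi; rewrite lexx ab.
have E : {in `]a, b[, derive1 Phi =1 speed g c}.
  move=> t; rewrite in_itv/= => /andP[t1 t2]; rewrite derive1E.
  by have [|_ ->] := D t; first by rewrite !ltW.
by rewrite /curve_length /Rintegral (continuous_FTC2 ab' cw LR E) -EFinB.
Qed.

End CurvePrimitive.

(** * The distance estimate *)

(** The difference is the excess, per unit of parameter, of the upper estimate for the transported
    length over K times the lower estimate for the length of the original curve. It is continuous in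
    e and vanishes at e = 0. *)
Lemma exponential_slack (R : realType) (sigma K eta : R) : 0 < K -> 0 < eta ->
  exists2 e : R, 0 < e & K * (expR (2 * e) * (sigma + e) - (sigma - e)) <= eta.
Proof.
move=> K0 eta0.
pose h (e : R) := K * (expR (2 * e) * (sigma + e) - (sigma - e)).
have ch : {for 0, continuous h}.
  apply: cvgM; first exact: cvg_cst.
  apply: cvgB; last by apply: cvgB; [exact: cvg_cst|exact: cvg_id].
  apply: cvgM; last by apply: cvgD; [exact: cvg_cst|exact: cvg_id].
  apply: (@continuous_comp _ _ _ (fun e : R => 2 * e) (@expR R)); last exact: continuous_expR.
  by apply: cvgM; [exact: cvg_cst|exact: cvg_id].
have h0 : h 0 = 0 by rewrite /h mulr0 expR0 mul1r addr0 subr0 subrr mulr0.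
move/cvgrPdist_lt : ch => /(_ eta eta0) /nbhs_ballP[d d0 Hd].
have d20 : 0 < d / 2 by rewrite divr_gt0.
exists (d / 2) => //; have := Hd (d / 2); rewrite h0 sub0r normrN -ball_normE/= sub0r normrN.
rewrite (gtr0_norm d20) ltr_pdivrMr// mulr_natr mulr2n ltrDl => /(_ d0).
by move=> H; apply: ltW; apply: le_lt_trans (ler_norm _) H.
Qed.

Section FlowCurves.
Context {R : realType} {n : nat} (M : manifold R n) (g : metric M) (X : vector_field M).
Implicit Types (p q : M) (x y c : R -> M) (J : set R).

Lemma integral_curve_runs x J u v : integral_curve_on X x J -> J u -> J v -> runs X x u v.
Proof.
move=> [oJ iJ H] Ju Jv t /andP[ut tv]; apply: H.
by apply: (iJ u v) => //; rewrite ut.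
Qed.

(** [flow X t p] may come from a different maximal curve for each t; [runs_unique] identifies them
    all with the one that reaches T. *)
Lemma flow_curve p (T : R) : 0 <= T ->
  (forall t : R, 0 <= t <= T -> flow_defined X t p) ->
  exists x, [/\ runs X x 0 T, x 0 = p & forall t, 0 <= t <= T -> flow X t p = x t].
Proof.
move=> T0 H.
have [y [x [J [[xJ J0 x0 _] JT _]]]] : flow_defined X T p by apply: H; rewrite T0 lexx.
exists x; split; [exact: (integral_curve_runs xJ J0 JT)|exact: x0|].
move=> t tT; have [t0 tT'] := andP tT.
have [x' [J' [[xJ' J0' x0' _] Jt' ->]]] : flow_graph X t p (flow X t p).
  by have [z Hz] := H t tT; apply: (@xgetPex _ p [set y | flow_graph X t p y]); exists z.
have JT' := xJ'.
apply: (@runs_unique _ _ _ g X x' x 0 t t0).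
- exact: integral_curve_runs xJ' J0' Jt'.
- by apply: runs_sub (integral_curve_runs xJ J0 JT).
- by rewrite x0' x0.
Qed.

Variables (c : R -> M) (J : set R) (a b T : R).
Hypotheses (ab : a <= b) (cJ : curve_C1_on c J) (abJ : `[a, b] `<=` J) (T0 : 0 <= T).
Hypothesis fdef : forall t s : R, 0 <= t <= T -> a <= s <= b -> flow_defined X t (c s).

Let cs s : a <= s <= b -> {for s, continuous c}.
Proof. by move=> sab; apply: (cJ.2 s _).1; apply: abJ; rewrite /= in_itv. Qed.

Let fcurve s : a <= s <= b -> exists x, [/\ runs X x 0 T, x 0 = c s &
  forall t, 0 <= t <= T -> flow X t (c s) = x t].
Proof. by move=> sab; apply: flow_curve => // t tT; exact: fdef. Qed.

Let near_curve s (P : M -> Prop) : a <= s <= b -> (\forall q \near c s, P q) ->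
  exists2 d : R, 0 < d & forall s', `|s' - s| < d -> P (c s').
Proof.
move=> sab N; have := cs sab N; rewrite /= nbhs_simpl => /nbhs_ballP[d d0 Hd].
by exists d => // s' s'd; apply: Hd; rewrite -ball_normE/= distrC.
Qed.

(** [flow_growth] along the curve through [c s] yields one bound for all curves starting near [c s];
    [cousin] in s makes it uniform, replacing compactness of the flow image. *)
Lemma nabla_norm_flow_bounded : exists B, forall s t, a <= s <= b -> 0 <= t <= T ->
  nabla_norm g X (flow X t (c s)) <= B.
Proof.
pose P u v := exists B, forall s t, a <= s <= b -> u <= s <= v -> 0 <= t <= T ->
  nabla_norm g X (flow X t (c s)) <= B.
suff [B HB] : P a b by exists B => s t sab tT; exact: HB.
apply: cousin => //.
  move=> u v w _ uv vw _ [B1 H1] [B2 H2]; exists (Num.max B1 B2) => s t sab /andP[us sw] tT.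
  rewrite le_max; have [sv|vs] := leP s v.
    by rewrite H1// us sv.
  by rewrite H2 ?orbT// (ltW vs).
move=> s sab; have [x [xr x0 _]] := fcurve sab.
have [C HC] := nabla_norm_path_bounded g X T0 (fun t h => (xr t h).1).
have [B N] := flow_growth ltr01 T0 xr HC ltr01 (@filterT _ (nbhs (x T)) _).
rewrite x0 in N.
have [d d0 Hd] := near_curve sab N; exists d => // u v _ _ su _ _ vs.
exists B => s' t s'ab /andP[us' s'v] tT.
have [y [yr y0 ->//]] := fcurve s'ab.
have s'd : `|s' - s| < d by rewrite ltr_distl (lt_le_trans su)//= (le_lt_trans s'v).
by have [_ _] := Hd s' s'd y yr y0; exact.
Qed.

Let S := c @` `[a, b].

Lemma nabla_norm_le_CT s t : a <= s <= b -> 0 <= t <= T ->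
  nabla_norm g X (flow X t (c s)) <= CT g X T S.
Proof.
have [B HB] := nabla_norm_flow_bounded.
have mem s' t' : a <= s' <= b -> 0 <= t' <= T -> flow_image X T S (flow X t' (c s')).
  move=> s'ab t'T; exists t', (c s'); split => //; last exact: fdef.
  by exists s' => //; rewrite /= in_itv.
move=> sab tT; apply: sup_upper_bound; last by exists (flow X t (c s)) => //; exact: mem.
split; first by exists (nabla_norm g X (flow X t (c s))); exists (flow X t (c s)) => //; exact: mem.
exists B => _ [_ [t' [_ [t'T [s' s'ab <-] _ ->]]] <-].
by apply: HB => //; move: s'ab; rewrite /= in_itv.
Qed.

Lemma flow_rdist_le t : 0 <= t <= T ->
  rdist g (flow X t (c a)) (flow X t (c b)) <=
    expR (CT g X T S * t) * curve_length g c a b.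
Proof.
move=> tT; have [t0 tT'] := andP tT; set C := CT g X T S; set K := expR (C * t).
have K0 : 0 < K by exact: expR_gt0.
have [Phi [dPhi ->]] := speed_primitive g cJ abJ ab.
apply/ler_addgt0Pl => eta0 eta00.
(* eta is the allowed excess per unit of parameter; the 1 added to b - a covers a = b. *)
have [eta [eta_gt0 etaE]] : exists eta : R, 0 < eta /\ eta * (b - a) <= eta0.
  have ba1 : 0 < b - a + 1 by rewrite ltr_wpDl// subr_ge0.
  exists (eta0 / (b - a + 1)); split; first by rewrite divr_gt0.
  by rewrite mulrAC ler_pdivrMr// ler_pM2l// lerDl.
pose F s := flow X t (c s).
pose P u v := exists l, chain g (F u) (F v) l /\ l <= K * (Phi v - Phi u) + eta * (v - u).
suff [l [Hl le_l]] : P a b.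
  apply: le_trans (reach_rdist (chain_reach Hl)) _; apply: le_trans le_l _.
  by rewrite addrC lerD2r.
apply: cousin => //.
  move=> u v w _ uv vw _ [l1 [c1 e1]] [l2 [c2 e2]]; exists (l1 + l2); split.
    exact: chain_cat c1 c2.
  by apply: le_trans (lerD e1 e2) _; rewrite le_eqVlt; apply/orP; left; apply/eqP; ring.
move=> s sab; have [x [xr x0 xF]] := fcurve sab.
have xr' : runs X x 0 t by exact: runs_sub xr.
have xC u : 0 <= u <= t -> nabla_norm g X (x u) <= C.
  move=> /andP[u0 ut]; have uT : 0 <= u <= T by rewrite u0 (le_trans ut).
  by rewrite -xF//; exact: nabla_norm_le_CT.
have [e e0 He] := exponential_slack (speed g c s) K0 eta_gt0.
(* The growth slack over a time t <= T contributes at most e / 2 to the exponent, the chart changes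
   e / 2, and the straight segments a further e, hence [expR (2 * e)]. T + 1 allows T = 0. *)
have e10 : 0 < e / (2 * (T + 1)) by rewrite divr_gt0// mulr_gt0// ltr_wpDl.
have e20 : 0 < e / 2 by rewrite divr_gt0.
set i := chart_at (x t); have ix : mdom i (x t) by exact: chart_atP.
have [r r0 Hr] := straight_piece g ix e0.
have [B N] := flow_growth e10 t0 xr' xC e20 (near_chart ix r0).
rewrite x0 in N.
have [d1 d10 H1] := near_curve sab N.
have Js : J s by apply: abJ; rewrite /= in_itv.
have [d2 d20 H2] := pnorm_curve g cJ Js e0.
have dPs := dPhi s sab; have [dP ePs] := dPs.
have [d3 d30 H3] := derivable_littleo dP e0.
rewrite derive1E ePs in H3.
exists (Num.min d1 (Num.min d2 d3)); first by rewrite !lt_min d10 d20.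
move=> u v au vb su us sv vs.
have dist_s w : u <= w -> w <= v -> [/\ `|w - s| < d1, `|w - s| < d2 & `|w - s| < d3].
  move=> uw wv; have : `|w - s| < Num.min d1 (Num.min d2 d3).
    by rewrite ltr_distl (lt_le_trans su)//= (le_lt_trans wv).
  by rewrite !lt_min => /and3P[].
have near_s w : a <= w <= b -> u <= w <= v ->
    [/\ mdom i (F w), `|mmap i (F w) - mmap i (x t)| < r &
      expR e * pnorm g (x t) (F w) <= expR (2 * e) * K * (speed g c s + e) * `|w - s|].
  move=> wab /andP[uw wv]; have [y [yr y0 yF]] := fcurve wab.
  have [wd1 wd2 _] := dist_s w uw wv.
  have yr' : runs X y 0 t by exact: runs_sub yr.
  have [[iy yd] yle _] := H1 w wd1 y yr' y0.
  rewrite /F yF//; split => //.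
  have := H2 w wd2.
  rewrite y0 subr0 in yle => pw.
  apply: (@le_trans _ _ (expR e * (expR ((C + e / (2 * (T + 1))) * t + e / 2) * ((speed g c s + e) * `|w - s|)))).
    rewrite ler_wpM2l ?expR_ge0//; apply: le_trans yle _.
    by rewrite ler_wpM2l ?expR_ge0.
  rewrite !mulrA ler_wpM2r// ler_wpM2r ?addr_ge0 ?speed_ge0 ?(ltW e0)//.
  rewrite /K -!expRD ler_expR.
  have : e / (2 * (T + 1)) * t <= e / 2.
    rewrite invfM mulrA -mulrA ler_piMr ?(ltW e20)// mulrC ler_pdivrMr ?mul1r ?ltr_wpDl//.
    by rewrite (le_trans tT')// lerDl.
  by move: (e / (2 * (T + 1))) => e'; lra.
have sab' : u <= s <= v by rewrite us.
have uab : a <= u <= b by rewrite au (le_trans us)// (le_trans sv).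
have vab : a <= v <= b by rewrite vb andbT (le_trans au)// (le_trans us).
have [iu ur ule] := near_s u uab (ltac:(by rewrite lexx (le_trans us))).
have [iv vr vle] := near_s v vab (ltac:(by rewrite lexx andbT (le_trans us))).
have rx : `|mmap i (x t) - mmap i (x t)| < r by rewrite subrr normr0.
(* The chain goes from F u through x t = F s to F v, both segments being measured by the metric at x
   t; the first is reversed by [gnN]. *)
have pu := Hr _ _ iu ix ur rx; have pv := Hr _ _ ix iv rx vr.
rewrite -gnN opprB in pu.
exists (0 + expR e * cnorm g i (x t) (F u) + expR e * cnorm g i (x t) (F v)); split.
  by apply: chain_cons pv; apply: chain_cons pu; exact: chain_nil.
rewrite add0r; apply: le_trans (lerD ule vle) _.
have uv' : u <= v by exact: le_trans sv.
have [_ _ ud3] := dist_s u (lexx u) uv'; have [_ _ vd3] := dist_s v uv' (lexx v).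
have := H3 u ud3; have := H3 v vd3.
rewrite (ger0_norm (_ : 0 <= v - s)) ?subr_ge0// (ler0_norm (_ : u - s <= 0)) ?subr_le0//.
rewrite -![_ *: _]/(_ * _) !ler_norml => /andP[hv _] /andP[_ hu].
set sg := speed g c s in hv hu He *.
have -> : expR (2 * e) * K * (sg + e) * - (u - s) + expR (2 * e) * K * (sg + e) * (v - s) =
  K * (expR (2 * e) * (sg + e)) * (v - u) by ring.
(* The expansions of Phi at s towards u and towards v add up because u <= s <= v. *)
have h1 : (sg - e) * (v - u) <= Phi v - Phi u.
  by move: hv hu; move: (Phi v) (Phi u) (Phi s) => A B' D; rewrite !mulrBl !mulrBr; lra.
have h2 := ler_wpM2l (ltW K0) h1.
have uv : 0 <= v - u by rewrite subr_ge0.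
have h3 := ler_wpM2r uv He.
apply: le_trans (lerD h2 h3).
by rewrite le_eqVlt; apply/orP; left; apply/eqP; ring.
Qed.

End FlowCurves.

Theorem corollary6 (R : realType) (n : nat) (M : manifold R n) (g : metric M)
    (X : vector_field M) (p0 q0 : M) (S : set M) :
  connected [set: M] ->
  geodesically_complete g ->
  minimizing_geodesic_segment g p0 q0 S ->
  (forall T : R, 0 < T ->
     (forall (t : R) (p : M), 0 <= t <= T -> S p -> flow_defined X t p) ->
     forall t : R, 0 <= t <= T ->
       rdist g (flow X t p0) (flow X t q0)
         <= rdist g p0 q0 * expR (CT g X T S * t)) /\
  (complete_field X ->
     forall T : R, 0 < T ->
     forall t : R, 0 <= t <= T ->
       rdist g (flow X t p0) (flow X t q0)
         <= rdist g p0 q0 * expR (CT g X T S * t)).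
Proof.
move=> _ _ [c [a [b [J [ab [abJ [_ [gJ [<- [<- [<- ->]]]]]]]]]]].
have cJ := geodesic_C1 gJ.
have main : forall T : R, 0 < T ->
     (forall (t : R) (p : M), 0 <= t <= T -> (c @` `[a, b]) p -> flow_defined X t p) ->
     forall t : R, 0 <= t <= T ->
       rdist g (flow X t (c a)) (flow X t (c b))
         <= curve_length g c a b * expR (CT g X T (c @` `[a, b]) * t).
  move=> T T0 H t tT; rewrite mulrC.
  have fd u s : 0 <= u <= T -> a <= s <= b -> flow_defined X u (c s).
    by move=> uT sab; apply: H => //; exists s => //; rewrite /= in_itv.
  exact: (flow_rdist_le g ab cJ abJ (ltW T0) fd tT).
split => // cX T T0; apply: main => // t p _ _.
have [x xmax] := cX p.
by exists (x t), x, setT; split.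
Qed.
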